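(* For normalized triples $U=(H,p,q)$ and $W=(K,r,s)$ (fixed points of $\operatorname{Can}$), identifying each with its variety $\mathcal U(H,p,q)$, $\mathcal U(K,r,s)$, and writing $\sigma(X)$ for the canonical signature of a subvariety $X$ of $\mathcal V$, $$U\subseteq W\iff H\supseteq K,\ p\ge r,\ q\ge s,$$ $$\sigma(U\wedge W)=\operatorname{Can}(H\cup K,\max\{p,r\},\max\{q,s\}),$$ $$\sigma(U\vee W)=(H\cap K,\min\{p,r\},\min\{q,s\}).$$ Every lower cover of $(H,p,q)$ in $\operatorname{Sub}(\mathcal V)$ occurs among the following at most twenty-seven candidates: add one missing element of $\mathcal F_{25}$ to $H$; if $p<\infty$, replace $(p,q)$ by $(p+1,\max\{q,p+1\})$; if $q<\infty$, replace $q$ by $q+1$. The lower covers are obtained by normalizing the candidates (applying $\operatorname{Can}$), removing the original node and duplicates, and keeping the inclusion-maximal remaining candidates.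
   Context: Language: two binary operations $+,\cdot$, no constants. $u\preceq v$ abbreviates $u+v\approx v$. Modulo the commutative ai-semiring axioms (both operations associative and commutative, $x+x\approx x$, distributivity) a term is a finite nonempty set (sum) of commutative monomials. The semiring $R_{12}$: its universe is $\{0,c,p,q,a,b\}$ (letters used as elements only in this paragraph); multiplication is commutative with only nonzero products $pb=bp=ab=ba=aq=qa=c$; addition is the join of the partial order generated by $a<p<0$, $b<q<0$, $c<0$, $a<c$, $b<q<c$. $\mathcal V=\mathsf V(R_{12})$ is the variety generated by $R_{12}$; $\mathcal V[E]$ is the subvariety of $\mathcal V$ defined by adjoining the identities in $E$; $\operatorname{Sub}(\mathcal V)$ is the lattice of subvarieties ($\wedge$ intersection, $\vee$ varietal join). In $\mathcal V$ all squares are equal and additively greatest; $0$ denotes this common value. Abbreviations: $C(t,u)=t+tu$, $D(t,u)=t+u+tu$, $L(a,b,c,d)=ab+bc+cd$ (all letters in identities are variables; the identity named $s$ below is unrelated to the threshold $s$ in the claim). $\mathcal F_{25}$ consists of the 25 identities: $\rho: x\preceq xy$; $\eta: z\preceq x+xy+yz$; $\omega: y\preceq x+xy$; $\zeta: z\preceq C(x,y)+zt$; $\lambda: z\preceq D(x,y)+xz$; $\eta_D: z\preceq x+xy+yz+D(t,u)$; $\omega_D: y\preceq C(x,y)+D(t,u)$; $\zeta_D: z\preceq D(x,y)+zt$; $\mu: ad\preceq b+L(a,b,c,d)$; $\nu: ad\preceq C(t,u)+L(a,b,c,d)$; $\mu_2: ad\preceq b+c+L(a,b,c,d)$; $\mu_D: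 ad\preceq b+L(a,b,c,d)+D(t,u)$; $\nu_D: ad\preceq L(a,b,c,d)+D(t,u)$; $\delta: ad\preceq L(a,b,c,d)$; $\xi: x^2\approx D(x,y)$; $\beta: xz\preceq C(x,y)+C(t,z)$; $s: x^2\approx C(x,y)$; $\chi: x^2\approx xy$; $\tau: x\approx y$; $\alpha: ad\preceq a+L(a,b,c,d)$; $\alpha_D: ad\preceq a+L(a,b,c,d)+D(t,u)$; $\varepsilon: ad\preceq a+b+c+L(a,b,c,d)$; $\kappa: ad\preceq a+b+L(a,b,c,d)$; $\iota_2: x_0x_5\preceq x_1+\sum_{j=0}^4x_jx_{j+1}$; $\iota_2^D: x_0x_5\preceq x_1+\sum_{j=0}^4x_jx_{j+1}+D(t,u)$. Each $f$ is read as $q_f\preceq v_f$: the square identities $\xi,s,\chi$ are read as $0\preceq v_f$ with $v_f=D(x,y),C(x,y),xy$, and $\tau$ as $y\preceq x$ (its query $y$ is a fresh linear variable). For $n\ge1$: $$\gamma_n:\ x_0y\preceq x_0+x_{2n}+\sum_{j=0}^{2n-1}x_jx_{j+1}+x_{2n}y,\qquad \gamma_n^D:\ x_0y\preceq x_0+x_{2n}+\sum_{j=0}^{2n-1}x_jx_{j+1}+x_{2n}y+D(t,u).$$ For $H\subseteq\mathcal F_{25}$, $0\le p\le q\le\infty$: $\mathcal U(H,p,q)=\mathcal V[H,\ \gamma_i:1\le i\le p,\ \gamma_j^D:1\le j\le q]$ (threshold $0$ gives an empty family, $\infty$ the whole family). Closure. For a term $v$: $M(v)$ is the set of variables occurring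 as linear summands; $G(v)$ has as edges the square-free quadratic summands, and as vertices only the variables incident with an edge; $W(v)=M(v)\cap V(G(v))$ is the set of marked vertices. A term is basic-zero if it contains a square, a monomial of degree at least three, or if $G(v)$ has an odd cycle; otherwise $G(v)$ is bipartite. A component is a D-component if both of its bipartition classes contain marked vertices. Environment rule: a basic-zero term becomes $0$; otherwise add all edges between marked vertices in opposite classes of the same component. If $\tau\in H$, all terms have the same normal form. If $\tau\notin H$, $C_{H,p,q}(v)$ is the least extension of the environment normal form of $v$ closed under: (1) for each $f\in H$ and each map of the variables of $v_f$ into the variables of the term (identifications allowed), include the image of $q_f$ whenever all image summands of $v_f$ are present; a square query is interpreted as $0$ and sends the result to $0$; (2) with $k=p$ if the current term has no D-component and $k=q$ otherwise, for any two marked vertices $x,x'$ in the same component and class at distance at most $2k$, join $x$ to every neighbour of $x'$ (for $k=\infty$ only the same component and class are required); (3) the environment rule. The operator $\operatorname{Can}(H,p,q)=(H^*,p^*,q^* )$: if $\tau\in H$ the result is $(\mathcal F_{25},\infty,\infty)$. Otherwise $$H^*=\{f\in\mathcal F_{25}:C_{H,p,q}(v_f)=0\text{ or }q_f\in C_{H,p,q}(v_f)\},$$ and, with $I_0=\{\rho,\omega,\zeta,\delta,\nu,\alpha,\beta,s,\chi,\tau,\iota_2\}$, $I_D=I_0\cup\{\omega_D,\zeta_D,\nu_D,\alpha_D,\xi,\iota_2^D\}$, $a=\max\{p,\mathbf 1_{\mu\in H}\}$, $b=\max\{q,\mathbf 1_{H\cap\{\mu,\mu_D\}\ne\varnothing}\}$: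 $p^*=\infty$ if $H\cap I_0\ne\varnothing$ or ($\eta\in H$ and $a\ge1$), and $p^*=a$ otherwise; $q^*=\infty$ if $H\cap I_D\ne\varnothing$ or ($H\cap\{\eta,\eta_D\}\ne\varnothing$ and $b\ge1$), and $q^*=b$ otherwise. The fixed points of $\operatorname{Can}$ are in bijection with $\operatorname{Sub}(\mathcal V)$ via $(H,p,q)\mapsto\mathcal U(H,p,q)$; the canonical signature $\sigma(X)$ of $X\in\operatorname{Sub}(\mathcal V)$ is the unique fixed point with $\mathcal U(\sigma(X))=X$. *)

(* Defs.v *)
From HB Require Import structures.
From mathcomp Require Import all_boot.
From mathcomp Require Import boolp classical_sets functions.

Set Implicit Arguments.
Unset Strict Implicit.
Unset Printing Implicit Defensive.

Local Open Scope classical_set_scope.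

Record algebra := Algebra {
  carrier :> Type;
  add : carrier -> carrier -> carrier;
  mul : carrier -> carrier -> carrier;
  carrier_inhabited : inhabited carrier
}.

Definition is_hom (A B : algebra) (f : A -> B) : Prop :=
  (forall x y, f (add x y) = add (f x) (f y)) /\
  (forall x y, f (mul x y) = mul (f x) (f y)).

Lemma prod_inhabited (I : Type) (A : I -> algebra) :
  inhabited (forall i, A i).
Proof.
have h i : exists _ : A i, True by case: (carrier_inhabited (A i)) => x; exists x.
exact: (inhabits (fun i => sval (cid (h i)))).
Qed.

Definition prod_algebra (I : Type) (A : I -> algebra) : algebra :=
  @Algebra (forall i, A i) (fun x y i => add (x i) (y i))
    (fun x y i => mul (x i) (y i)) (prod_inhabited A).

Definition closed_H (K : set algebra) : Prop :=
  forall (A B : algebra) (f : A -> B),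
    is_hom f -> (forall y, exists x, f x = y) -> K A -> K B.

Definition closed_S (K : set algebra) : Prop :=
  forall (A B : algebra) (f : A -> B),
    is_hom f -> injective f -> K B -> K A.

Definition closed_P (K : set algebra) : Prop :=
  forall (I : Type) (A : I -> algebra),
    (forall i, K (A i)) -> K (prod_algebra A).

Definition is_variety (K : set algebra) : Prop :=
  [/\ closed_H K, closed_S K & closed_P K].

Definition variety_generated (K : set algebra) : set algebra :=
  [set A | forall Z, is_variety Z -> K `<=` Z -> Z A].

Definition variety_join (X Y : set algebra) : set algebra :=
  variety_generated (X `|` Y).

Inductive term := Var of nat | Add of term & term | Mul of term & term.

Fixpoint eval (A : algebra) (e : nat -> A) (t : term) : A :=
  match t with
  | Var i => e i
  | Add t1 t2 => add (eval e t1) (eval e t2)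
  | Mul t1 t2 => mul (eval e t1) (eval e t2)
  end.

Definition identity := (term * term)%type.

Definition satisfies (A : algebra) (i : identity) : Prop :=
  forall e : nat -> A, eval e i.1 = eval e i.2.

Definition adjoin (V : set algebra) (E : set identity) : set algebra :=
  V `&` [set A | forall i, E i -> satisfies A i].

Inductive R12_elt := R0 | Rc | Rp | Rq | Ra | Rb.

Definition R12_mul (x y : R12_elt) : R12_elt :=
  match x, y with
  | Rp, Rb | Rb, Rp | Ra, Rb | Rb, Ra | Ra, Rq | Rq, Ra => Rc
  | _, _ => R0
  end.

Inductive R12_le : R12_elt -> R12_elt -> Prop :=
  | R12_refl x : R12_le x x
  | R12_trans x y z : R12_le x y -> R12_le y z -> R12_le x z
  | R12_ap : R12_le Ra Rp
  | R12_p0 : R12_le Rp R0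
  | R12_bq : R12_le Rb Rq
  | R12_q0 : R12_le Rq R0
  | R12_c0 : R12_le Rc R0
  | R12_ac : R12_le Ra Rc
  | R12_qc : R12_le Rq Rc.

Definition R12_add (x y : R12_elt) : R12_elt :=
  match x, y with
  | Ra, Ra => Ra
  | Rb, Rb => Rb
  | Ra, Rp | Rp, Ra | Rp, Rp => Rp
  | Rb, Rq | Rq, Rb | Rq, Rq => Rq
  | Rc, (Ra | Rb | Rq | Rc) | (Ra | Rb | Rq), Rc
  | Ra, (Rb | Rq) | (Rb | Rq), Ra => Rc
  | _, _ => R0
  end.

Lemma R12_leE (x y : R12_elt) : R12_le x y <-> R12_add x y = y.
Proof.
split; last first.
  by case: x y => [] [] // _; do ?[exact: R12_refl | by constructor 3
    | by constructor 4 | by constructor 5 | by constructor 6 | by constructor 7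
    | by constructor 8 | by constructor 9 | exact: R12_trans R12_ap R12_p0
    | exact: R12_trans R12_bq R12_q0 | exact: R12_trans R12_bq R12_qc].
elim=> {x y} //; first by case.
by case=> [] [] [].
Qed.

Lemma R12_add_join (x y z : R12_elt) :
  R12_le (R12_add x y) z <-> R12_le x z /\ R12_le y z.
Proof. by rewrite !R12_leE; case: x y z => [] [] []; split=> // -[]. Qed.

Definition R12 : algebra := Algebra R12_add R12_mul (inhabits R0).

Definition VR12 : set algebra := variety_generated [set R12].

Definition subvariety : set (set algebra) :=
  [set X | is_variety X /\ X `<=` VR12].

Declare Scope term_scope.
Delimit Scope term_scope with T.
Bind Scope term_scope with term.
Local Infix "+" := Add : term_scope.
Local Infix "*" := Mul : term_scope.

Definition preceq (u v : term) : identity := (u + v, v)%T.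

Inductive F25 :=
  | f_rho | f_eta | f_omega | f_zeta | f_lambda
  | f_etaD | f_omegaD | f_zetaD | f_mu | f_nu
  | f_mu2 | f_muD | f_nuD | f_delta | f_xi
  | f_beta | f_s | f_chi | f_tau | f_alpha
  | f_alphaD | f_epsilon | f_kappa | f_iota2 | f_iota2D.

Definition F25_seq : seq F25 :=
  [:: f_rho; f_eta; f_omega; f_zeta; f_lambda;
      f_etaD; f_omegaD; f_zetaD; f_mu; f_nu;
      f_mu2; f_muD; f_nuD; f_delta; f_xi;
      f_beta; f_s; f_chi; f_tau; f_alpha;
      f_alphaD; f_epsilon; f_kappa; f_iota2; f_iota2D].

Definition F25_index (f : F25) : 'I_25 :=
  inord match f with
  | f_rho => 0 | f_eta => 1 | f_omega => 2 | f_zeta => 3 | f_lambda => 4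
  | f_etaD => 5 | f_omegaD => 6 | f_zetaD => 7 | f_mu => 8 | f_nu => 9
  | f_mu2 => 10 | f_muD => 11 | f_nuD => 12 | f_delta => 13 | f_xi => 14
  | f_beta => 15 | f_s => 16 | f_chi => 17 | f_tau => 18 | f_alpha => 19
  | f_alphaD => 20 | f_epsilon => 21 | f_kappa => 22 | f_iota2 => 23
  | f_iota2D => 24
  end.

Lemma F25_indexK : cancel F25_index (fun i : 'I_25 => nth f_rho F25_seq i).
Proof. by case; rewrite /F25_index inordK. Qed.

HB.instance Definition _ := Finite.copy F25 (can_type F25_indexK).

Section Identities.

Let x := Var 0.
Let y := Var 1.
Let z := Var 2.
Let t := Var 3.
Let u := Var 4.
Let a := Var 5.
Let b := Var 6.
Let c := Var 7.
Let d := Var 8.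
(* x_0, x_1, x_2, ..., distinct from the nine variables above *)
Let X j := Var (9 + j).

Local Open Scope term_scope.

Definition termC (v w : term) : term := v + v * w.
Definition termD (v w : term) : term := v + w + v * w.
Definition termL (v1 v2 v3 v4 : term) : term := v1 * v2 + v2 * v3 + v3 * v4.

(* x_0 x_1 + x_1 x_2 + ... + x_n x_(n+1) *)
Fixpoint chain (n : nat) : term :=
  match n with
  | 0 => X 0 * X 1
  | n'.+1 => chain n' + X n'.+1 * X n'.+2
  end.

Definition query (f : F25) : term :=
  match f with
  | f_rho => x
  | f_eta | f_zeta | f_lambda | f_etaD | f_zetaD => z
  | f_omega | f_omegaD => y
  | f_mu | f_nu | f_mu2 | f_muD | f_nuD | f_delta
  | f_alpha | f_alphaD | f_epsilon | f_kappa => a * d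
  | f_beta => x * z
  | f_xi | f_s | f_chi => x * x
  | f_tau => y
  | f_iota2 | f_iota2D => X 0 * X 5
  end.

Definition premise (f : F25) : term :=
  match f with
  | f_rho => x * y
  | f_eta => x + x * y + y * z
  | f_omega => x + x * y
  | f_zeta => termC x y + z * t
  | f_lambda => termD x y + x * z
  | f_etaD => x + x * y + y * z + termD t u
  | f_omegaD => termC x y + termD t u
  | f_zetaD => termD x y + z * t
  | f_mu => b + termL a b c d
  | f_nu => termC t u + termL a b c d
  | f_mu2 => b + c + termL a b c d
  | f_muD => b + termL a b c d + termD t u
  | f_nuD => termL a b c d + termD t u
  | f_delta => termL a b c d
  | f_xi => termD x y
  | f_beta => termC x y + termC t z
  | f_s => termC x y
  | f_chi => x * y
  | f_tau => x
  | f_alpha => a + termL a b c d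
  | f_alphaD => a + termL a b c d + termD t u
  | f_epsilon => a + b + c + termL a b c d
  | f_kappa => a + b + termL a b c d
  | f_iota2 => X 1 + chain 4
  | f_iota2D => X 1 + chain 4 + termD t u
  end.

Definition identity_of (f : F25) : identity :=
  match f with
  | f_xi | f_s | f_chi => (query f, premise f)
  | f_tau => (x, y)
  | _ => preceq (query f) (premise f)
  end.

(* The sum over 0 <= j <= 2n-1 is [chain (2n-1)]; these are only used for
   n >= 1. *)
Definition gamma_premise (n : nat) : term :=
  X 0 + X n.*2 + chain n.*2.-1 + X n.*2 * y.

Definition gamma (n : nat) : identity := preceq (X 0 * y) (gamma_premise n).

Definition gammaD (n : nat) : identity :=
  preceq (X 0 * y) (gamma_premise n + termD t u).

End Identities.

(* [None] is infinity *)
Definition threshold := option nat.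

Definition tle (p q : threshold) : bool :=
  match p, q with
  | _, None => true
  | None, Some _ => false
  | Some m, Some n => m <= n
  end.

Definition tmax (p q : threshold) : threshold := if tle p q then q else p.
Definition tmin (p q : threshold) : threshold := if tle p q then p else q.

Definition triple := ({set F25} * threshold * threshold)%type.

Definition variety_of (w : triple) : set algebra :=
  let: (H, p, q) := w in
  adjoin VR12
    ([set identity_of f | f in [set` H]]
     `|` [set gamma i | i in [set i | (1 <= i) && tle (Some i) p]]
     `|` [set gammaD j | j in [set j | (1 <= j) && tle (Some j) q]]).

(* A commutative monomial is the increasingly sorted list of its variables. *)
Definition monomial := seq nat.

Definition mono2 (x y : nat) : monomial := sort leq [:: x; y].

Fixpoint monomials (v : term) : seq monomial :=
  match v with
  | Var i => [:: [:: i]]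
  | Add v1 v2 => monomials v1 ++ monomials v2
  | Mul v1 v2 => [seq sort leq (m1 ++ m2) | m1 <- monomials v1, m2 <- monomials v2]
  end.

Definition rename (phi : nat -> nat) (m : monomial) : monomial :=
  sort leq (map phi m).

Section Graph.

Variable T : set monomial.

Definition edge : rel nat := fun x y => (x != y) && (mono2 x y \in T).

Definition marked (x : nat) : Prop := T [:: x] /\ exists y, edge x y.

Definition basic_zero : Prop :=
  [\/ exists x, T (mono2 x x),
      exists2 m, T m & 3 <= size m
    | exists c, [/\ 3 <= size c, odd (size c) & ucycle edge c]].

(* In a bipartite graph, two vertices of a component lie in the same class
   iff the walks joining them have even length. *)
Definition same_class (x y : nat) : Prop :=
  exists c, [/\ path edge x c, last x c = y & ~~ odd (size c)].

Definition opposite_class (x y : nat) : Prop :=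
  exists c, [/\ path edge x c, last x c = y & odd (size c)].

Definition distance_le (n x y : nat) : Prop :=
  exists c, [/\ path edge x c, last x c = y & size c <= n].

Definition has_D_component : Prop :=
  exists x y, [/\ marked x, marked y & opposite_class x y].

End Graph.

(* Terms modulo the ai-semiring axioms are represented by their sets of
   monomials, and normal forms by [option (set monomial)], where [None]
   is 0. *)
Definition environment (T : set monomial) : option (set monomial) :=
  if `[< basic_zero T >] then None
  else Some (T `|` [set m | exists x y,
    [/\ marked T x, marked T y, opposite_class T x y & m = mono2 x y]]).

(* When the image of the query is a square, T becomes basic-zero, so no
   T <> 0 containing the image of the premise is closed. *)
Definition identity_closed (H : {set F25}) (T : set monomial) : Prop :=
  forall (f : F25) (phi : nat -> nat), f \in H ->
    (forall m, m \in monomials (premise f) -> T (rename phi m)) ->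
    (forall m, m \in monomials (query f) -> T (rename phi m)).

Definition threshold_closed (k : threshold) (T : set monomial) : Prop :=
  forall x x' z, marked T x -> marked T x' -> same_class T x x' ->
    (if k is Some n then distance_le T n.*2 x x' else True) ->
    edge T x' z -> T (mono2 x z).

Definition closed_term (H : {set F25}) (p q : threshold) (T : set monomial) :
  Prop :=
  [/\ identity_closed H T,
      threshold_closed (if `[< has_D_component T >] then q else p) T
    & environment T = Some T].

Lemma edge_sub (T T' : set monomial) : T `<=` T' -> subrel (edge T) (edge T').
Proof.
by move=> sT x y /andP[nxy /set_mem hT]; rewrite /edge nxy; exact/mem_set/sT.
Qed.

Lemma marked_sub (T T' : set monomial) : T `<=` T' -> marked T `<=` marked T'.
Proof.
move=> sT x [hx [y hy]]; split; first exact: sT.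
by exists y; exact: edge_sub hy.
Qed.

Lemma same_class_sub (T T' : set monomial) x y :
  T `<=` T' -> same_class T x y -> same_class T' x y.
Proof.
by move=> sT [c [hc hl ho]]; exists c; split=> //; exact: sub_path (edge_sub sT) _ _ hc.
Qed.

Lemma opposite_class_sub (T T' : set monomial) x y :
  T `<=` T' -> opposite_class T x y -> opposite_class T' x y.
Proof.
by move=> sT [c [hc hl ho]]; exists c; split=> //; exact: sub_path (edge_sub sT) _ _ hc.
Qed.

Lemma distance_le_sub (T T' : set monomial) n n' x y :
  T `<=` T' -> n <= n' -> distance_le T n x y -> distance_le T' n' x y.
Proof.
move=> sT nn [c [hc hl hs]]; exists c; split=> //; last exact: leq_trans nn.
exact: sub_path (edge_sub sT) _ _ hc.
Qed.

Lemma has_D_component_sub (T T' : set monomial) :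
  T `<=` T' -> has_D_component T -> has_D_component T'.
Proof.
move=> sT [x [y [hx hy hxy]]]; exists x, y.
by split; [exact: marked_sub hx|exact: marked_sub hy|exact: opposite_class_sub hxy].
Qed.

Lemma basic_zero_sub (T T' : set monomial) :
  T `<=` T' -> basic_zero T -> basic_zero T'.
Proof.
move=> sT [[x hx]|[m hm s3]|[c [s3 so /andP[hc uc]]]].
- by constructor 1; exists x; exact: sT.
- by constructor 2; exists m => //; exact: sT.
- constructor 3; exists c; split=> //; rewrite /ucycle uc andbT.
  exact: sub_cycle (edge_sub sT) _ hc.
Qed.

Lemma environment_fixP (T : set monomial) :
  environment T = Some T <->
  ~ basic_zero T /\ (forall x y, marked T x -> marked T y ->
                       opposite_class T x y -> T (mono2 x y)).
Proof.
rewrite /environment; split.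
  case: asboolP => // nz [eT]; split=> // x y hx hy hxy.
  by rewrite -eT; right; exists x, y.
move=> [nz hT]; case: asboolP => // _; congr Some.
by apply/seteqP; split=> [m [//|[x [y [hx hy hxy ->]]]]|m hm]; [exact: hT|left].
Qed.

Lemma closed_term_bigcap (H : {set F25}) (p q : threshold)
    (S : set (set monomial)) :
  tle p q -> S !=set0 -> S `<=` closed_term H p q ->
  closed_term H p q (\bigcap_(T in S) T).
Proof.
move=> pq [T0 ST0] hS; set I := \bigcap_(T in S) T.
have sI T : S T -> I `<=` T by move=> ST; exact: bigcap_inf.
split.
- move=> f phi fH hf m hm T ST; have [h1 _ _] := hS _ ST.
  by apply: (h1 f phi fH) => // m' /hf; exact: sI.
- move=> x x' z hx hx' hxx hd e T ST; have [_ h2 _] := hS _ ST.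
  have sT := sI _ ST.
  apply: (h2 x x' z); first exact: marked_sub hx.
  + exact: marked_sub hx'.
  + exact: same_class_sub hxx.
  + have: tle (if `[< has_D_component I >] then q else p)
              (if `[< has_D_component T >] then q else p).
      case: asboolP => hI; case: asboolP => hT //; try by case: (q) => //=.
        by case: hT; exact: has_D_component_sub hI.
      by case: (p) => //=.
    move: hd; case: (if _ then _ else _) => [n|] hd;
      case: (if _ then _ else _) => [n'|] //= nn.
    by apply: distance_le_sub hd => //; rewrite leq_double.
  + exact: edge_sub e.
- apply/environment_fixP; split.
    move=> /(basic_zero_sub (sI _ ST0)).
    by have [_ _ /environment_fixP[]] := hS _ ST0.
  move=> x y hx hy hxy T ST; have sT := sI _ ST.
  have [_ _ /environment_fixP[_ h3]] := hS _ ST.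
  by apply: h3; [exact: marked_sub hx|exact: marked_sub hy
    |exact: opposite_class_sub hxy].
Qed.

(* 0 contains every term and is closed; hence the least closed extension is
   the intersection of the nonzero closed extensions if there is one
   (see [closed_term_bigcap]), and 0 otherwise. *)
Definition term_closure (H : {set F25}) (p q : threshold) (v : term) :
  option (set monomial) :=
  if f_tau \in H then None else
  if environment [set` monomials v] is Some T0 then
    if `[< exists T, T0 `<=` T /\ closed_term H p q T >] then
      Some [set m | forall T, T0 `<=` T -> closed_term H p q T -> T m]
    else None
  else None.

Definition I_0 : {set F25} :=
  [set f in [:: f_rho; f_omega; f_zeta; f_delta; f_nu; f_alpha; f_beta; f_s;
                f_chi; f_tau; f_iota2]]%SET.

Definition I_D : {set F25} :=
  (I_0 :|: [set f in [:: f_omegaD; f_zetaD; f_nuD; f_alphaD; f_xi;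
                         f_iota2D]])%SET.

Definition normalize (w : triple) : triple :=
  let: (H, p, q) := w in
  if f_tau \in H then (finset.setT, None, None) else
  let Hs := [set f | if term_closure H p q (premise f) is Some T
                     then all (fun m => m \in T) (monomials (query f))
                     else true]%SET in
  let a := tmax p (Some (nat_of_bool (f_mu \in H))) in
  let b := tmax q (Some (nat_of_bool ((f_mu \in H) || (f_muD \in H)))) in
  let ps := if (H :&: I_0 != finset.set0)%SET
               || (f_eta \in H) && tle (Some 1) a
            then None else a in
  let qs := if (H :&: I_D != finset.set0)%SET
               || ((f_eta \in H) || (f_etaD \in H)) && tle (Some 1) b
            then None else b in
  (Hs, ps, qs).

Definition normalized : set triple :=
  [set w | tle w.1.2 w.2 /\ normalize w = w].

(* The default value is irrelevant on Sub(V), where such a w exists uniquely. *)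
Definition signature (X : set algebra) : triple :=
  xget (finset.set0, Some 0, Some 0)
    [set w | normalized w /\ variety_of w = X].

Definition lower_cover (X Y : set algebra) : Prop :=
  [/\ subvariety X, subvariety Y, X `<` Y
    & ~ exists Z, [/\ subvariety Z, X `<` Z & Z `<` Y]].

Definition candidates (w : triple) : seq triple :=
  let: (H, p, q) := w in
  [seq ((f |: H)%SET, p, q) | f <- enum (~: H)%SET]
  ++ (if p is Some m then [:: (H, Some m.+1, tmax q (Some m.+1))] else [::])
  ++ (if q is Some m then [:: (H, p, Some m.+1)] else [::]).

Definition normalized_candidates (w : triple) : seq triple :=
  undup [seq c <- [seq normalize c | c <- candidates w] | c != w].

Definition maximal_candidates (w : triple) : seq triple :=
  [seq c <- normalized_candidates w |
    all (fun c' => ~~ `[< variety_of c `<` variety_of c' >])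
        (normalized_candidates w)].

(* Main.v *)
(* A normalized triple is recovered from its variety, so everything follows
   once [normalize] is a closure operator on triples which does not change the
   variety: unions and intersections of triples then compute meets and joins,
   and a strictly larger normalized triple lies above the normalization of some
   candidate.
   Soundness: in an algebra of the variety, the monomials lying below a value
   [v] which is not greatest form a closed set of monomials.
   Idempotence: for every identity which forces a threshold to infinity (or to
   be positive), a finite closed graph shows that it is not derivable from
   identities which do not. *)
Require Import Defs.
From mathcomp Require Import all_boot zify.
From mathcomp Require Import boolp classical_sets functions.

Set Implicit Arguments.
Unset Strict Implicit.
Unset Printing Implicit Defensive.

Local Open Scope classical_set_scope.

Local Notation "x +' y" := (Defs.add x y) (at level 50, left associativity).
Local Notation "x *' y" := (Defs.mul x y) (at level 40, left associativity).

(** * Varieties *)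

(** The explicit formulas for the thresholds are the obstacle: they read only [H] and the old
    thresholds, so applying them again after [H] has grown might push them further. Each identity
    that could do so is excluded by a closed set containing its premise but not its query, and two
    families of such sets suffice. When a finite threshold is positive, eta is absent, and the
    premise is closed under mu so that no class of a component has two marks, which makes every
    gamma rule vacuous. When the threshold is 0, mu is absent, and the premise is closed under eta,
    the gamma rules being trivial at distance 0. For the identities themselves, idempotence and
    invariance of the variety rest on one fact, [closed_term_star]: a set closed for a triple is
    closed for its normalization. Inequalities in the variety are never derived syntactically. They
    are checked on the six elements of [R12], where chains of products of any length are controlled
    by the parity of walks. *)

Lemma eval_hom (A B : algebra) (f : A -> B) (e : nat -> A) (t : term) :
  is_hom f -> f (eval e t) = eval (f \o e) t.
Proof.
by move=> [fD fM]; elim: t => [//|t IHt s IHs|t IHt s IHs] /=;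
  rewrite ?fD ?fM IHt IHs.
Qed.

Lemma satisfies_variety (i : identity) :
  is_variety [set A : algebra | satisfies A i].
Proof.
split.
- move=> A B f fh fs sA e.
  have [g gK] := choice fs.
  have -> : e = f \o (g \o e) by apply/funext => n /=; rewrite gK.
  by rewrite -!(eval_hom _ _ fh) sA.
- by move=> A B f fh fi sB e; apply: fi; rewrite !(eval_hom _ _ fh) sB.
- move=> I A sA e; apply/functional_extensionality_dep => j.
  have hj : @is_hom (prod_algebra A) (A j) (fun x => x j) by [].
  by rewrite !(eval_hom _ _ hj); exact: sA.
Qed.

Lemma variety_generated_variety (K : set algebra) :
  is_variety (variety_generated K).
Proof.
split.
- move=> A B f fh fs hA Z vZ KZ; have [vH _ _] := vZ.
  by apply: vH fh fs _; exact: hA.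
- move=> A B f fh fi hB Z vZ KZ; have [_ vS _] := vZ.
  by apply: vS fh fi _; exact: hB.
- move=> I A hA Z vZ KZ; have [_ _ vP] := vZ.
  by apply: vP => i; exact: hA.
Qed.

Lemma sub_variety_generated (K : set algebra) : K `<=` variety_generated K.
Proof. by move=> A KA Z _; apply. Qed.

Lemma variety_generated_min (K Z : set algebra) :
  is_variety Z -> K `<=` Z -> variety_generated K `<=` Z.
Proof. by move=> vZ KZ A; apply. Qed.

Lemma adjoin_variety (V : set algebra) (E : set identity) :
  is_variety V -> is_variety (adjoin V E).
Proof.
move=> [vH vS vP]; split.
- move=> A B f fh fs [VA EA]; split; first exact: vH fh fs VA.
  by move=> i Ei; have [h _ _] := satisfies_variety i; exact: h fh fs (EA i Ei).
- move=> A B f fh fi [VB EB]; split; first exact: vS fh fi VB.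
  by move=> i Ei; have [_ h _] := satisfies_variety i; exact: h fh fi (EB i Ei).
- move=> I A hA; split; first by apply: vP => i; have [] := hA i.
  move=> i Ei; have [_ _ h] := satisfies_variety i.
  by apply: h => j; have [_] := hA j; apply.
Qed.

Lemma VR12_satisfies (A : algebra) (i : identity) :
  VR12 A -> satisfies R12 i -> satisfies A i.
Proof.
move=> VA sR; apply: VA (satisfies_variety i) _.
by move=> B ->.
Qed.

Lemma variety_of_subvariety (w : triple) : subvariety (variety_of w).
Proof.
case: w => [[H p] q]; split; last by move=> A [].
exact/adjoin_variety/variety_generated_variety.
Qed.

Lemma subvariety_join (X Y : set algebra) :
  subvariety X -> subvariety Y -> subvariety (variety_join X Y).
Proof.
move=> [vX sX] [vY sY]; split; first exact: variety_generated_variety.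
apply: variety_generated_min; first exact: variety_generated_variety.
by move=> A [/sX|/sY].
Qed.

(** * Inequalities in the variety generated by R12 *)

Definition leA (A : algebra) (x y : A) : bool := `[< x +' y = y >].

Section VR12Theory.

Variables (A : algebra) (VA : VR12 A).
Implicit Types (x y z v : A) (e : nat -> A).

Let env x y z (i : nat) : A := if i is i'.+1 then if i' is 0 then y else z else x.

Lemma addAC x y z : x +' (y +' z) = x +' y +' z.
Proof.
have h := VR12_satisfies VA
  (i := (Add (Var 0) (Add (Var 1) (Var 2)), Add (Add (Var 0) (Var 1)) (Var 2))).
apply: (h _ (env x y z)) => f /=.
by case: (f 0) (f 1) (f 2) => [] [] [].
Qed.

Lemma addCC x y : x +' y = y +' x.
Proof.
have h := VR12_satisfies VA (i := (Add (Var 0) (Var 1), Add (Var 1) (Var 0))).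
by apply: (h _ (env x y y)) => f /=; case: (f 0) (f 1) => [] [].
Qed.

Lemma addxx x : x +' x = x.
Proof.
have h := VR12_satisfies VA (i := (Add (Var 0) (Var 0), Var 0)).
by apply: (h _ (env x x x)) => f /=; case: (f 0).
Qed.

Lemma mulCC x y : x *' y = y *' x.
Proof.
have h := VR12_satisfies VA (i := (Mul (Var 0) (Var 1), Mul (Var 1) (Var 0))).
by apply: (h _ (env x y y)) => f /=; case: (f 0) (f 1) => [] [].
Qed.

Lemma leAxx x : leA x x.
Proof. by apply/asboolP; exact: addxx. Qed.

Lemma leA_trans y x z : leA x y -> leA y z -> leA x z.
Proof. by move=> /asboolP xy /asboolP <-; apply/asboolP; rewrite addAC xy. Qed.

Lemma leA_add x y v : leA (x +' y) v = leA x v && leA y v.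
Proof.
apply/idP/andP => [/asboolP xyv|[/asboolP xv /asboolP yv]]; last first.
  by apply/asboolP; rewrite -addAC yv.
split; apply/asboolP; rewrite -xyv.
  by rewrite !addAC addxx.
by rewrite !addAC (addCC y) -(addAC x y) addxx.
Qed.

Definition sum_term (t : term) (ts : seq term) : term := foldr Add t ts.

Lemma leA_sum_term e v t ts :
  leA (eval e (sum_term t ts)) v = all (fun s => leA (eval e s) v) (t :: ts).
Proof.
elim: ts => [|s ts IHts] /=; first by rewrite andbT.
by rewrite leA_add IHts /= andbCA.
Qed.

End VR12Theory.

Lemma VR12_R12 : VR12 R12.
Proof. exact: sub_variety_generated. Qed.

(** A sum lies below [v] exactly when its summands do, so an implication between bounds by [v] is an
    identity in disguise and transfers from [R12]. From here on it suffices to inspect [R12]. *)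
Lemma VR12_inequality (A : algebra) (q t : term) (ts : seq term) : VR12 A ->
  (forall (e : nat -> R12) (v : R12),
     all (fun s => leA (eval e s) v) (t :: ts) -> leA (eval e q) v) ->
  forall (e : nat -> A) (v : A),
    all (fun s => leA (eval e s) v) (t :: ts) -> leA (eval e q) v.
Proof.
move=> VA hR e v; rewrite -leA_sum_term //; apply: leA_trans => //.
have sA : satisfies A (preceq q (sum_term t ts)).
  apply: VR12_satisfies => // f; apply/asboolP.
  by apply: hR; rewrite -leA_sum_term ?leAxx //; exact: VR12_R12.
by apply/asboolP; exact: sA.
Qed.

Lemma square_top (A : algebra) (x y v : A) : VR12 A -> leA (x *' x) v -> leA y v.
Proof.
move=> VA xv.
have /= := @VR12_inequality A (Var 1) (Mul (Var 0) (Var 0)) [::] VA _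
  (fun i => if i is 0 then x else y) v.
rewrite andbT; apply => // f w; rewrite /= andbT => /asboolP h; apply/asboolP.
by move: h => /=; case: (f 0) (f 1) w => [] [] [].
Qed.

Definition walk_terms (x : nat) (c : seq nat) : seq term :=
  pairmap (fun y z => Mul (Var y) (Var z)) x c.

Lemma all_walk_terms (A : algebra) (e : nat -> A) v x c :
  all (fun s => leA (eval e s) v) (walk_terms x c) =
  path (fun y z => leA (e y *' e z) v) x c.
Proof. by elim: c x => //= y c IHc x; rewrite IHc. Qed.

(* The graph of nonzero products of R12 is the path p - b - a - q. *)
Definition R12_class (x : R12) : bool := if x is (Ra | Rp) then true else false.

Lemma R12_edge_class (x y v : R12) : v <> R0 -> leA (x *' y) v ->
  R12_class x = ~~ R12_class y.
Proof. by move=> v0 /asboolP; case: x y v v0 => [] [] []. Qed.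

Lemma R12_walk_class (e : nat -> R12) (v : R12) (x : nat) (c : seq nat) :
  v <> R0 -> path (fun y z => leA (e y *' e z) v) x c ->
  R12_class (e (last x c)) = odd (size c) (+) R12_class (e x).
Proof.
move=> v0; elim: c x => [//|y c IHc] x /= /andP[xy /IHc ->].
by rewrite (R12_edge_class v0 xy) addNb addbN negbK.
Qed.

Lemma R12_top (x : R12) : leA x (R0 : R12).
Proof. by apply/asboolP; case: x. Qed.

(** A product below [v <> R0] is [Rc], and bounding [x] or [y] by [R0] is excluded, so [v = Rc].
    Then [x] and [y] are not [Rp], hence among [Ra], [Rb], [Rq]; opposite classes leave only the
    products ab and aq, both equal to c. *)
Lemma R12_opposite_edge (x y z z' v : R12) : v <> R0 ->
  leA x v -> leA y v -> leA (x *' z) v -> leA (z' *' y) v ->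
  R12_class y = true (+) R12_class x -> leA (x *' y) v.
Proof.
move=> v0 /asboolP xv /asboolP yv /asboolP xz /asboolP zy c; apply/asboolP.
by move: v0 xv yv xz zy c; case: x => //; case: y => //; case: v => //;
  case: z => //; case: z' => //.
Qed.

Section VR12Walks.

Variables (A : algebra) (VA : VR12 A) (e : nat -> A) (v : A).

Let adj : rel nat := fun y z => leA (e y *' e z) v.

(** An odd closed walk would change the class of its starting point, so over [R12] it forces the
    bound [R0]. *)
Lemma odd_walk_top (x : nat) (c : seq nat) (y : A) :
  path adj x c -> last x c = x -> odd (size c) -> leA y v.
Proof.
move=> pc lc oc; apply: (@square_top A (e x)) => //.
case: c pc lc oc => [//|z c] pc lc oc.
apply: (@VR12_inequality A (Mul (Var x) (Var x)) (Mul (Var x) (Var z))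
  (walk_terms z c) VA); last first.
  by rewrite /= all_walk_terms; exact: pc.
move=> f w; rewrite /= all_walk_terms => pf; case: (EM (w = R0)) => [->|w0].
  exact: R12_top.
have := @R12_walk_class f w x (z :: c) w0 pf.
by rewrite lc oc; case: (R12_class _).
Qed.

(** This is the environment rule in algebraic form. The first and the last step of the walk provide
    the products of [x] and of [y] that [R12_opposite_edge] requires. *)
Lemma odd_walk_edge (x y : nat) (c : seq nat) :
  path adj x c -> last x c = y -> odd (size c) ->
  leA (e x) v -> leA (e y) v -> adj x y.
Proof.
move=> pc lc oc xv yv.
apply: (@VR12_inequality A (Mul (Var x) (Var y)) (Var x)
  (Var y :: walk_terms x c) VA); last first.
  by rewrite /= all_walk_terms xv yv; exact: pc.
move=> f w; rewrite /= all_walk_terms => /and3P[xw yw pf].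
case: (EM (w = R0)) => [->|w0]; first exact: R12_top.
have := @R12_walk_class f w x c w0 pf; rewrite lc oc.
have pos : exists z, leA (f x *' z) w.
  by case: (c) pf oc => //= z ? /andP[? _] _; exists (f z).
have pos' : exists z, leA (z *' f y) w.
  case/lastP: (c) lc oc pf => //= s z; rewrite last_rcons rcons_path => <- _.
  by move=> /andP[_ ?]; exists (f (last x s)).
case: pos pos' => [z xz] [z' yz'] clxy.
exact: R12_opposite_edge w0 xw yw xz yz' clxy.
Qed.

End VR12Walks.

(** * Graphs of sets of monomials *)

Lemma mono2C (x y : nat) : mono2 x y = mono2 y x.
Proof.
apply/perm_sortP; [exact: leq_total|exact: leq_trans|exact: anti_leq|].
by rewrite -[[:: x; y]]/([:: x] ++ [:: y]) perm_catC.
Qed.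

Lemma sort_leq_perm (s t : seq nat) : perm_eq s t -> sort leq s = sort leq t.
Proof.
by move=> st; apply/perm_sortP;
  [exact: leq_total|exact: leq_trans|exact: anti_leq|].
Qed.

Lemma rename_sort (phi : nat -> nat) (m : monomial) :
  rename phi (sort leq m) = rename phi m.
Proof. by apply: sort_leq_perm; rewrite perm_map // perm_sort. Qed.

Lemma rename_mono2 (phi : nat -> nat) (x y : nat) :
  rename phi (mono2 x y) = mono2 (phi x) (phi y).
Proof. exact: rename_sort. Qed.

Lemma rename_comp (phi psi : nat -> nat) (m : monomial) :
  rename phi (rename psi m) = rename (phi \o psi) m.
Proof. by rewrite [rename psi m]/rename rename_sort /rename map_comp. Qed.

Lemma uniqPn_split (T : eqType) (s : seq T) :
  ~~ uniq s -> exists y s1 s2 s3, s = s1 ++ y :: s2 ++ y :: s3.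
Proof.
elim: s => [//|x s IHs] /=; rewrite negb_and negbK.
case/orP => [/splitPr [s2 s3]|/IHs [y [s1 [s2 [s3 ->]]]]].
  by exists x, [::], s2, s3.
by exists y, (x :: s1), s2, s3.
Qed.

(** * Parity of walks, and pulling a graph back along a renaming *)

Section Walks.

Variable T : set monomial.

Lemma edge_sym : symmetric (edge T).
Proof. by move=> x y; rewrite /edge eq_sym mono2C. Qed.

Lemma edge_mono2 (x y : nat) : edge T x y -> T (mono2 x y).
Proof. by case/andP => _ /set_mem. Qed.

Lemma rev_walk (x : nat) (c : seq nat) : path (edge T) x c ->
  exists c', [/\ path (edge T) (last x c) c', last (last x c) c' = x
    & size c' = size c].
Proof.
move=> pc; exists (rev (belast x c)); split.
- by rewrite rev_path -(eq_path (e := edge T)) // => y z; rewrite edge_sym.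
- by case: c pc => //= y c _; rewrite rev_cons last_rcons.
- by rewrite size_rev size_belast.
Qed.

(** Induction on the length: a repeated vertex splits the walk into two shorter closed walks, one of
    which is odd. Without repetition it is a cycle, of length at least 3 because there are no
    loops. *)
Lemma odd_closed_walk (x : nat) (c : seq nat) :
  path (edge T) x c -> last x c = x -> odd (size c) -> basic_zero T.
Proof.
have [n] := ubnP (size c); elim: n x c => // n IHn x c.
rewrite ltnS => szc pc lc oc; case: (boolP (uniq c)) => [uc|].
  constructor 3; exists c; split=> //; last first.
    rewrite /ucycle uc andbT; case/lastP: c lc pc {szc oc uc} => // c y.
    by rewrite last_rcons => <- pc; rewrite -rot1_cons rot_cycle.
  case: c pc lc oc {szc uc} => [//|y [|z [|t c]]] //= /andP[xy _] yx.
  by move: xy; rewrite yx /edge eqxx.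
case/uniqPn_split => y [s1 [s2 [s3 cE]]]; move: pc lc oc szc.
rewrite cE !cat_path /= !cat_path /= !last_cat /= !last_cat /=.
case/and5P => p1 e1 p2 e2 p3 lc oc szc.
move: oc szc; rewrite !(size_cat, size_rcons) /= !size_cat /= => oc szc.
case: (boolP (odd (size s2).+1)) => o2.
  apply: (IHn y (rcons s2 y)); rewrite ?last_rcons ?size_rcons //; first lia.
  by rewrite rcons_path p2.
apply: (IHn x (s1 ++ y :: s3)); rewrite ?cat_path ?last_cat ?size_cat //=.
- lia.
- by rewrite p1 e1.
- move: oc o2; rewrite !addnS /= !oddD /=.
  by case: (odd (size s1)); case: (odd (size s2)); case: (odd (size s3)).
Qed.

Lemma walk_odd_eq (x : nat) (c c' : seq nat) : ~ basic_zero T ->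
  path (edge T) x c -> path (edge T) x c' -> last x c = last x c' ->
  odd (size c) = odd (size c').
Proof.
move=> nz pc pc' lcc'; have [d [pd ld sd]] := rev_walk pc'.
apply/eqP/negPn/negP => ne; apply: nz; apply: (@odd_closed_walk x (c ++ d)).
- by rewrite cat_path pc lcc'.
- by rewrite last_cat lcc'.
- by rewrite size_cat sd oddD -negb_eqb.
Qed.

Lemma same_class_sym (x y : nat) : same_class T x y -> same_class T y x.
Proof.
move=> [c [pc lc oc]]; have [d [pd ld sd]] := rev_walk pc.
by exists d; rewrite -lc sd.
Qed.

Lemma same_class_edge (x y z : nat) :
  same_class T x y -> edge T y z -> opposite_class T x z.
Proof.
move=> [c [pc lc oc]] yz; exists (rcons c z).
by rewrite rcons_path pc lc yz last_rcons size_rcons.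
Qed.

(** The walk is even and is followed two edges at a time, so [P] is only asked for on the class of
    [x]. *)
Lemma same_class_ind (P : nat -> Prop) (x y : nat) : same_class T x y ->
  P x -> (forall u w v, P u -> edge T u w -> edge T w v -> P v) -> P y.
Proof.
move=> [c [pc lc oc]] Px step.
have [n] := ubnP (size c); elim: n x c pc lc oc Px => // n IHn x.
case=> [_ <- //|w [//|v c]] /= /and3P[xw wv pc] lc oc Px szc.
apply: (IHn v c) => //; last lia; first by rewrite -[odd _]negbK.
exact: step xw wv.
Qed.

Section NonZero.

Hypothesis nz : ~ basic_zero T.

Lemma mono2_edge (x y : nat) : T (mono2 x y) -> edge T x y.
Proof.
move=> Txy; rewrite /edge (mem_set Txy) andbT; apply/eqP => xy.
by apply: nz; constructor 1; exists x; move: Txy; rewrite -xy.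
Qed.

(** If [phi] identified the two ends, the image would be a square, which [nz] forbids. *)
Lemma preimage_edge (phi : nat -> nat) (x y : nat) :
  edge (rename phi @^-1` T) x y -> edge T (phi x) (phi y).
Proof. by move/andP => [_ /set_mem]; rewrite /= rename_mono2 => /mono2_edge. Qed.

Lemma preimage_path (phi : nat -> nat) (x : nat) (c : seq nat) :
  path (edge (rename phi @^-1` T)) x c -> path (edge T) (phi x) (map phi c).
Proof. exact/homo_path/preimage_edge. Qed.

Lemma preimage_marked (phi : nat -> nat) (x : nat) :
  marked (rename phi @^-1` T) x -> marked T (phi x).
Proof. by move=> [Tx [y /preimage_edge xy]]; split=> //; exists (phi y). Qed.

Lemma preimage_opposite_class (phi : nat -> nat) (x y : nat) :
  opposite_class (rename phi @^-1` T) x y -> opposite_class T (phi x) (phi y).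
Proof.
move=> [c [/preimage_path pc <- oc]]; exists (map phi c).
by rewrite last_map size_map.
Qed.

Lemma preimage_same_class (phi : nat -> nat) (x y : nat) :
  same_class (rename phi @^-1` T) x y -> same_class T (phi x) (phi y).
Proof.
move=> [c [/preimage_path pc <- oc]]; exists (map phi c).
by rewrite last_map size_map.
Qed.

Lemma preimage_distance_le (phi : nat -> nat) (n x y : nat) :
  distance_le (rename phi @^-1` T) n x y -> distance_le T n (phi x) (phi y).
Proof.
move=> [c [/preimage_path pc <- oc]]; exists (map phi c).
by rewrite last_map size_map.
Qed.

Lemma preimage_has_D_component (phi : nat -> nat) :
  has_D_component (rename phi @^-1` T) -> has_D_component T.
Proof.
move=> [x [y [/preimage_marked mx /preimage_marked my]]].
by move=> /preimage_opposite_class xy; exists (phi x), (phi y).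
Qed.

(** The image of an odd cycle may repeat vertices; it is only an odd closed walk, which is why
    [odd_closed_walk] is stated for walks. *)
Lemma preimage_not_basic_zero (phi : nat -> nat) :
  ~ basic_zero (rename phi @^-1` T).
Proof.
case=> [[x]|[m /= Tm sm]|[[|x c] [//= _ oc /andP[pc _]]]].
- by rewrite /= rename_mono2 => Txx; apply: nz; constructor 1; exists (phi x).
- by apply: nz; constructor 2; exists (rename phi m); rewrite ?size_sort ?size_map.
- apply: nz; apply: (@odd_closed_walk (phi x) (map phi (rcons c x))).
  + exact: preimage_path.
  + by rewrite last_map last_rcons.
  + by rewrite size_map size_rcons.
Qed.

End NonZero.

End Walks.

(** * Order, maximum and minimum of thresholds *)

Lemma tle_refl (p : threshold) : tle p p.
Proof. by case: p => /=. Qed.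

Lemma tle_trans (q p r : threshold) : tle p q -> tle q r -> tle p r.
Proof. by case: p q r => [p|] [q|] [r|] //= pq; apply: leq_trans pq. Qed.

Lemma tle_anti (p q : threshold) : tle p q -> tle q p -> p = q.
Proof.
by case: p q => [p|] [q|] //= pq qp; congr Some; apply/eqP; rewrite eqn_leq pq.
Qed.

Lemma tle_max (r p q : threshold) : tle (tmax p q) r = tle p r && tle q r.
Proof.
by rewrite /tmax; case: p q r => [p|] [q|] [r|] //=;
  rewrite ?andbT ?andbF //; case: ifP => /=; lia.
Qed.

Lemma tle_min (r p q : threshold) : tle r (tmin p q) = tle r p && tle r q.
Proof.
by rewrite /tmin; case: p q r => [p|] [q|] [r|] //=;
  rewrite ?andbT ?andbF //; case: ifP => /=; lia.
Qed.

Lemma Some_tle_max (i : nat) (p q : threshold) :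
  tle (Some i) (tmax p q) = tle (Some i) p || tle (Some i) q.
Proof.
by rewrite /tmax; case: p q => [p|] [q|] //=; rewrite ?orbT //;
  case: ifP => /=; lia.
Qed.

Lemma threshold_closed_le (k k' : threshold) (T : set monomial) :
  tle k' k -> threshold_closed k T -> threshold_closed k' T.
Proof.
move=> kk' hk x x' z mx mx' xx' dk; apply: hk => //.
case: k k' kk' dk => [k|] [k'|] //= kk'.
by apply: distance_le_sub => //; rewrite leq_double.
Qed.

(** * The closure operator *)

(* Equality on [F25] goes through [inord] and does not compute. *)
Definition F25_code (f : F25) : nat :=
  match f with
  | f_rho => 0 | f_eta => 1 | f_omega => 2 | f_zeta => 3 | f_lambda => 4
  | f_etaD => 5 | f_omegaD => 6 | f_zetaD => 7 | f_mu => 8 | f_nu => 9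
  | f_mu2 => 10 | f_muD => 11 | f_nuD => 12 | f_delta => 13 | f_xi => 14
  | f_beta => 15 | f_s => 16 | f_chi => 17 | f_tau => 18 | f_alpha => 19
  | f_alphaD => 20 | f_epsilon => 21 | f_kappa => 22 | f_iota2 => 23
  | f_iota2D => 24
  end.

Lemma F25_eqE (f g : F25) : (f == g) = (F25_code f == F25_code g).
Proof. by apply/eqP/eqP => [->//|]; case: f; case: g. Qed.

Definition holds (phi : nat -> nat) (T : set monomial) (t : term) : Prop :=
  forall m, m \in monomials t -> T (rename phi m).

Lemma holds_Add (phi : nat -> nat) (T : set monomial) (t s : term) :
  holds phi T (Add t s) = (holds phi T t /\ holds phi T s).
Proof.
apply/propext; split=> [h|[ht hs] m]; first by split=> m hm;
  apply: h; rewrite /= mem_cat hm ?orbT.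
by rewrite /= mem_cat => /orP[/ht|/hs].
Qed.

Lemma holds_Var (phi : nat -> nat) (T : set monomial) (i : nat) :
  holds phi T (Var i) = T [:: phi i].
Proof.
apply/propext; split=> [h|h m]; last by rewrite inE => /eqP ->.
by apply: (h [:: i]); rewrite inE.
Qed.

Lemma holds_Mul (phi : nat -> nat) (T : set monomial) (i j : nat) :
  holds phi T (Mul (Var i) (Var j)) = T (mono2 (phi i) (phi j)).
Proof.
rewrite -rename_mono2; apply/propext; split=> [|h m]; first by apply; rewrite inE.
by rewrite inE => /eqP ->.
Qed.

Definition holdsE := (holds_Add, holds_Mul, holds_Var).

Lemma monomials_sorted (t : term) (m : monomial) :
  m \in monomials t -> sort leq m = m.
Proof.
elim: t m => [i|t IHt s IHs|t _ s _] m /=.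
- by rewrite inE => /eqP ->.
- by rewrite mem_cat => /orP[/IHt|/IHs].
- case/allpairsP => -[m1 m2] [_ _ ->] /=.
  by rewrite sorted_sort //; [exact: leq_trans|exact/sort_sorted/leq_total].
Qed.

Lemma holds_id (T : set monomial) (t : term) :
  holds id T t <-> [set` monomials t] `<=` T.
Proof.
split=> h m /= hm; have := h m hm; rewrite /rename map_id //.
  by rewrite (monomials_sorted hm).
by rewrite (monomials_sorted hm).
Qed.

Definition threshold_of (p q : threshold) (T : set monomial) : threshold :=
  if `[< has_D_component T >] then q else p.

Lemma threshold_of_le (p q p' q' : threshold) (T : set monomial) :
  tle p p' -> tle q q' -> tle (threshold_of p q T) (threshold_of p' q' T).
Proof. by rewrite /threshold_of; case: ifP. Qed.

Lemma closed_term_nz (H : {set F25}) (p q : threshold) (T : set monomial) :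
  closed_term H p q T -> ~ basic_zero T.
Proof. by case=> _ _ /environment_fixP[]. Qed.

Lemma closed_term_env (H : {set F25}) (p q : threshold) (T : set monomial) :
  closed_term H p q T -> forall x y, marked T x -> marked T y ->
    opposite_class T x y -> T (mono2 x y).
Proof. by case=> _ _ /environment_fixP[]. Qed.

Lemma closed_term_anti (H H' : {set F25}) (p q p' q' : threshold) :
  H \subset H' -> tle p p' -> tle q q' ->
  closed_term H' p' q' `<=` closed_term H p q.
Proof.
move=> HH pp qq T [ic tc ev]; split=> //.
  by move=> f phi /(fintype.subsetP HH); exact: ic.
by apply: threshold_closed_le tc; exact: threshold_of_le.
Qed.

(** Pulling back can lose the D-component, in which case the threshold drops from [q] to [p]; this
    is where [tle p q] enters. *)
Lemma preimage_closed (H : {set F25}) (p q : threshold) (T : set monomial)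
    (phi : nat -> nat) :
  tle p q -> closed_term H p q T -> closed_term H p q (rename phi @^-1` T).
Proof.
move=> pq cT; have nz := closed_term_nz cT; have [ic tc _] := cT; split.
- move=> f psi fH hf m hm; rewrite /= rename_comp; apply: ic hm => // m' /hf /=.
  by rewrite rename_comp.
- have : tle (threshold_of p q (rename phi @^-1` T)) (threshold_of p q T).
    rewrite /threshold_of; case: asboolP => hD; case: asboolP => hD' //;
      rewrite ?tle_refl //.
    by case: hD'; exact: preimage_has_D_component hD.
  move/threshold_closed_le => /(_ _ tc) tc' x x' z mx mx' xx' dk x'z.
  rewrite /= rename_mono2; apply: (tc' (phi x) (phi x')).
  + exact: preimage_marked.
  + exact: preimage_marked.
  + exact: preimage_same_class.
  + move: dk; rewrite -/(threshold_of p q _); case: threshold_of => // n.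
    exact: preimage_distance_le.
  + exact: preimage_edge.
- apply/environment_fixP; split; first exact: preimage_not_basic_zero.
  move=> x y mx my xy; rewrite /= rename_mono2; apply: (closed_term_env cT).
  + exact: preimage_marked.
  + exact: preimage_marked.
  + exact: preimage_opposite_class.
Qed.

Lemma environment_sub (T0 T T1 : set monomial) : environment T = Some T ->
  T0 `<=` T -> environment T0 = Some T1 -> T1 `<=` T.
Proof.
move=> /environment_fixP[nz ev] sT; rewrite /environment.
case: asboolP => // _ [<-] m [/sT //|[x [y [mx my xy ->]]]]; apply: ev.
- exact: marked_sub mx.
- exact: marked_sub my.
- exact: opposite_class_sub xy.
Qed.

Definition derives (H : {set F25}) (p q : threshold) (v t : term) : Prop :=
  forall T, closed_term H p q T -> holds id T v -> holds id T t.

(** Membership in the least closed extension means validity in every closed set containing [v]. The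
    value 0 means that there is no such set, and then [derives] holds vacuously. *)
Lemma term_closureP (H : {set F25}) (p q : threshold) (v t : term) :
  f_tau \notin H ->
  is_true (if term_closure H p q v is Some T
           then all (fun m => m \in T) (monomials t) else true) <-> derives H p q v t.
Proof.
move=> tH; rewrite /term_closure (negbTE tH) /derives.
case env0 : environment => [T0|]; last first.
  split=> // _ T cT /holds_id sT.
  move: env0; rewrite /environment; case: asboolP => // bz _.
  by case: (closed_term_nz cT); exact: basic_zero_sub bz.
have sub0 : [set` monomials v] `<=` T0.
  by move: env0; rewrite /environment; case: asboolP => // _ [<-] m; left.
have sup0 T : closed_term H p q T -> holds id T v -> T0 `<=` T.
  by move=> [_ _ ev] /holds_id sT; exact: environment_sub sT env0.
case: asboolP => [_|none]; last first.
  split=> // _ T cT hT; case: none; exists T; split=> //; exact: sup0.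
split=> [/allP h T cT hT|h]; last first.
  apply/allP => m hm; apply/mem_set => T sT cT.
  by have /holds_id := h T cT (iffRL (holds_id T v) (subset_trans sub0 sT)); apply.
apply/holds_id => m /h /set_mem /=; apply=> //; exact: sup0.
Qed.

Definition star_H (H : {set F25}) (p q : threshold) : {set F25} :=
  [set f | `[< derives H p q (premise f) (query f) >]]%SET.

Definition max_p (H : {set F25}) (p : threshold) : threshold :=
  tmax p (Some (nat_of_bool (f_mu \in H))).

Definition max_q (H : {set F25}) (q : threshold) : threshold :=
  tmax q (Some (nat_of_bool ((f_mu \in H) || (f_muD \in H)))).

Definition star_p (H : {set F25}) (p : threshold) : threshold :=
  if (H :&: I_0 != finset.set0)%SET || (f_eta \in H) && tle (Some 1) (max_p H p)
  then None else max_p H p.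

Definition star_q (H : {set F25}) (q : threshold) : threshold :=
  if (H :&: I_D != finset.set0)%SET ||
     ((f_eta \in H) || (f_etaD \in H)) && tle (Some 1) (max_q H q)
  then None else max_q H q.

Lemma normalize_tau (H : {set F25}) (p q : threshold) :
  f_tau \in H -> normalize (H, p, q) = (finset.setT, None, None).
Proof. by rewrite /normalize => ->. Qed.

Lemma normalizeE (H : {set F25}) (p q : threshold) : f_tau \notin H ->
  normalize (H, p, q) = (star_H H p q, star_p H p, star_q H q).
Proof.
move=> tH; rewrite /normalize (negbTE tH); congr (_, _, _).
apply/finset.setP => f; rewrite !inE.
have [h1 h2] := term_closureP p q (premise f) (query f) tH.
by apply/idP/asboolP.
Qed.

Lemma star_HP (H : {set F25}) (p q : threshold) (f : F25) :
  (f \in star_H H p q) <-> derives H p q (premise f) (query f).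
Proof. by rewrite inE; split=> /asboolP. Qed.

Lemma sub_star_H (H : {set F25}) (p q : threshold) : H \subset star_H H p q.
Proof.
apply/fintype.subsetP => f fH; apply/star_HP => T [ic _ _]; exact: ic.
Qed.

Lemma star_H_sub (H H' : {set F25}) (p q p' q' : threshold) :
  H \subset H' -> tle p p' -> tle q q' -> star_H H p q \subset star_H H' p' q'.
Proof.
move=> HH pp qq; apply/fintype.subsetP => f /star_HP h; apply/star_HP => T cT.
by apply: h; exact: closed_term_anti cT.
Qed.

(** [derives] only concerns the variables as they stand. An arbitrary substitution [phi] is obtained
    by applying it to the preimage of [T] under [phi]. *)
Lemma identity_closed_star (H : {set F25}) (p q : threshold) (T : set monomial) :
  tle p q -> closed_term H p q T -> identity_closed (star_H H p q) T.
Proof.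
move=> pq cT f phi /star_HP h hf m hm.
have := h _ (preimage_closed phi pq cT) _ m hm.
rewrite /= rename_comp; apply=> m' /hf /=.
by rewrite rename_comp.
Qed.

(** The set containing only the monomial x separates the premise of tau from its query. It is closed
    because it has no edge and every other premise contains a product. *)
Lemma tauNstar_H (H : {set F25}) (p q : threshold) :
  f_tau \notin H -> f_tau \notin star_H H p q.
Proof.
move=> tH; apply/negP => /star_HP /(_ [set [:: 0]]).
rewrite /= !holdsE => h; suff /h : closed_term H p q [set [:: 0]] by move/(_ erefl).
have noE x y : ~ ([set [:: 0]] (mono2 x y)).
  by move=> /(congr1 size); rewrite size_sort.
have noe x y : ~ edge [set [:: 0]] x y by move/edge_mono2; exact: noE.
split.
- move=> f phi fH; rewrite -!/(holds phi _ _).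
  by case: f fH => fH; rewrite ?(negbTE tH) // in fH *;
    rewrite /= /termC /termD /termL !holdsE; intuition;
    case: (noE _ _ ltac:(eassumption)).
- by move=> x x' z _ _ _ _ /noe.
- apply/environment_fixP; split=> [|x y [_ [z /noe]]] //.
  case=> [[x /noE]|[m ->]|[[|x [|y c]] [//]]] //.
  by move=> _ _ /andP[/= /andP[/noe]].
Qed.

(** Entry i of [s] is the image of variable number i; a 0 fills the place of a variable that does
    not occur in the identity. *)
Local Ltac rule s :=
  match goal with R : forall s, _ -> holds _ _ _ |- _ =>
    have := R s; rewrite /= /termC /termD /termL !holdsE /=; intuition
  end.

(** * Identities that raise the thresholds *)

Section ClosedTerm.

Variables (H : {set F25}) (p q : threshold) (T : set monomial).
Hypothesis cT : closed_term H p q T.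

Let nz : ~ basic_zero T := closed_term_nz cT.

Lemma closed_rule (f : F25) (s : seq nat) : f \in H ->
  holds (nth 0 s) T (premise f) -> holds (nth 0 s) T (query f).
Proof. by have [ic _ _] := cT; exact: ic. Qed.

Lemma D_component_edge : has_D_component T ->
  exists t u, [/\ T [:: t], T [:: u] & T (mono2 t u)].
Proof.
move=> [t [u [mt mu tu]]]; exists t, u; split; [by case: mt|by case: mu|].
exact: (closed_term_env cT).
Qed.

(** Each of these identities either joins [x] to [z] at any distance between [x] and [x'], or forces
    a square. Those outside [I_0] need an image of D(t,u), supplied by the D-component. *)
Lemma threshold_infinite (f : F25) : f \in H -> f != f_tau ->
  (f \in I_0) || (f \in I_D) && `[< has_D_component T >] ->
  threshold_closed None T.
Proof.
move=> fH ftau fI x x' z mx mx' xx' _ x'z.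
have [Tx [w xw]] := mx; have [Tx' _] := mx'.
have eT := @edge_mono2 T.
have eT' y y' : edge T y y' -> T (mono2 y' y) by rewrite mono2C; exact: eT.
have noSq y : ~ T (mono2 y y) by move=> h; apply: nz; constructor 1; exists y.
(* The vertex [z] lies in the class opposite to [x], so once marked it is joined to [x] by the
   environment rule. *)
have byMark : T [:: z] -> T (mono2 x z).
  move=> Tz; apply: (closed_term_env cT mx); last exact: same_class_edge x'z.
  by split=> //; exists x'; rewrite edge_sym.
(* The neighbour [z] is kept fixed while the other end moves from [x'] to [x], two edges at a
   time. *)
have byWalk : (forall u w v, T (mono2 z u) -> edge T u w -> edge T w v ->
    T (mono2 z v)) -> T (mono2 x z).
  move=> step; rewrite mono2C.
  apply: (same_class_ind (P := fun u => T (mono2 z u)) (same_class_sym xx')) => //.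
  exact: eT'.
(* Here [x] is kept fixed: all neighbours of the moving vertex are neighbours of [x]. This suits
   alpha, which needs its mark at an end of the new edge. *)
have byFan : (forall u w v n, T (mono2 x w) -> edge T u w -> edge T w v ->
    edge T v n -> T (mono2 x n)) -> T (mono2 x z).
  move=> step.
  suff : forall n, edge T x' n -> T (mono2 x n) by apply.
  apply: (same_class_ind (P := fun u => forall n, edge T u n -> T (mono2 x n))
    xx') => [n|]; first exact: eT.
  by move=> u w' v hu uw wv n vn; exact: step (hu _ uw) uw wv vn.
have hD : f \notin I_0 -> exists t u, [/\ T [:: t], T [:: u] & T (mono2 t u)].
  by move=> fN; move: fI; rewrite (negbTE fN) => /andP[_ /asboolP /D_component_edge].
have R s := closed_rule (s := s) fH.
move: fI ftau hD R; rewrite !inE !F25_eqE.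
case: f fH => //= fH fI _ hD R.
- apply: byMark; rule [:: z; x'].
- apply: byMark; rule [:: x'; z].
- apply: byMark; rule [:: x'; z; z; x'].
- have [t [u [Tt Tu Ttu]]] := hD isT.
  apply: byMark; rule [:: x'; z; 0; t; u].
- have [t [u [Tt Tu Ttu]]] := hD isT.
  apply: byMark; rule [:: t; u; z; x'].
- apply: byWalk => a b c za ab bc; rule [:: 0; 0; 0; x; w; z; a; b; c].
- have [t [u [Tt Tu Ttu]]] := hD isT.
  apply: byWalk => a b c za ab bc; rule [:: 0; 0; 0; t; u; z; a; b; c].
- apply: byWalk => a b c za ab bc; rule [:: 0; 0; 0; 0; 0; z; a; b; c].
- have [t [u [Tt Tu Ttu]]] := hD isT.
  case: (noSq t); rule [:: t; u].
- rule [:: x; w; z; x'].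
- case: (noSq x); rule [:: x; w].
- case: (noSq x); rule [:: x; w].
- apply: byFan => a b c n xb ab bc cn; rule [:: 0; 0; 0; 0; 0; x; b; c; n].
- have [t [u [Tt Tu Ttu]]] := hD isT.
  apply: byFan => a b c n xb ab bc cn; rule [:: 0; 0; 0; t; u; x; b; c; n].
- apply: byWalk => a b c za ab bc.
  (* The five-edge chain backtracks through z, x', z before going on to a, b, c, so that its second
     vertex is the marked [x']. *)
  rule [:: 0; 0; 0; 0; 0; 0; 0; 0; 0; z; x'; z; a; b; c].
- have [t [u [Tt Tu Ttu]]] := hD isT.
  apply: byWalk => a b c za ab bc.
  rule [:: 0; 0; 0; t; u; 0; 0; 0; 0; z; x'; z; a; b; c].
Qed.

(** Take the marked vertex of mu to be [x']: mu joins [z], a neighbour of [x'], to every vertex two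
    steps away from [x']. *)
Lemma threshold_one : f_mu \in H \/
    f_muD \in H /\ has_D_component T -> threshold_closed (Some 1) T.
Proof.
move=> hmu; suff far u w v z : T [:: u] -> edge T u w -> edge T w v ->
    edge T u z -> T (mono2 v z).
  move=> x x' z [Tx _] [Tx' _] [c [pc lc oc]] [d [pd ld sd]] x'z.
  (* Walks with the same ends have the same parity, so a walk of length at most 2 has length 0 or 2
     here. *)
  have : odd (size d) = odd (size c).
    by apply: (walk_odd_eq nz pd pc); rewrite lc ld.
  case: d pd ld sd => [_ /= -> _ _|w [_ _ _ /= o1|v [|//]]].
  - exact: edge_mono2.
  - by move: oc; rewrite -o1.
  - move=> /and3P[xw wv _] /= vx' _ _; apply: (far x' w x z) => //.
      by rewrite edge_sym -vx'.
    by rewrite edge_sym.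
have eT := @edge_mono2 T.
have eT' y y' : edge T y y' -> T (mono2 y' y) by rewrite mono2C; exact: eT.
move=> Tu uw wv uz; rewrite mono2C; case: hmu => [fH|[fH /D_component_edge hD]].
  have R s := closed_rule (s := s) fH.
  rule [:: 0; 0; 0; 0; 0; z; u; w; v].
have [t [u' [Tt Tu' Ttu]]] := hD; have R s := closed_rule (s := s) fH.
rule [:: 0; 0; 0; t; u'; z; u; w; v].
Qed.

(** By eta, marks spread along the whole class, so gamma_1 can be iterated along a walk of any
    length. *)
Lemma threshold_eta : f_eta \in H \/
    f_etaD \in H /\ has_D_component T ->
  threshold_closed (Some 1) T -> threshold_closed None T.
Proof.
move=> heta t1; have eT := @edge_mono2 T.
suff prop u w v : T [:: u] -> edge T u w -> edge T w v -> T [:: v].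
  move=> x x' z mx mx' xx' _ x'z.
  suff [_] : T [:: x] /\ edge T z x by rewrite edge_sym; exact: eT.
  apply: (same_class_ind (P := fun u => T [:: u] /\ edge T z u)
    (same_class_sym xx')); first by rewrite edge_sym; case: mx'.
  move=> u w v [Tu zu] uw wv; have Tv := prop _ _ _ Tu uw wv; split=> //.
  rewrite edge_sym; apply: (mono2_edge nz); apply: (t1 v u z).
  - by split=> //; exists w; rewrite edge_sym.
  - by split=> //; exists w.
  - by exists [:: w; u]; split; rewrite //= [edge T v w]edge_sym wv edge_sym uw.
  - by exists [:: w; u]; split; rewrite //= [edge T v w]edge_sym wv edge_sym uw.
  - by rewrite edge_sym.
move=> Tu /eT uw /eT wv; case: heta => [fH|[fH /D_component_edge hD]].
  have R s := closed_rule (s := s) fH; rule [:: u; w; v].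
have [t [u' [Tt Tu' Ttu]]] := hD; have R s := closed_rule (s := s) fH.
rule [:: u; w; v; t; u'].
Qed.

End ClosedTerm.

Lemma I_0_sub_I_D : I_0 \subset I_D.
Proof. exact: finset.subsetUl. Qed.

Lemma closed_term_star (H : {set F25}) (p q : threshold) (T : set monomial) :
  f_tau \notin H -> tle p q -> closed_term H p q T ->
  closed_term (star_H H p q) (star_p H p) (star_q H q) T.
Proof.
move=> tH pq cT; have [ic tc ev] := cT; split=> //.
  exact: identity_closed_star cT.
rewrite -/(threshold_of p q T) in tc; rewrite -/(threshold_of _ _ T).
have inf (I : {set F25}) : (H :&: I != finset.set0)%SET ->
    (forall f, f \in I -> (f \in I_0) || (f \in I_D) && `[< has_D_component T >]) ->
    threshold_closed None T.
  move=> /finset.set0Pn [f /finset.setIP[fH fI]] h.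
  by apply: (threshold_infinite cT fH) (h f fI); apply: contraNneq tH => <-.
have mu k (b : bool) : threshold_closed k T ->
    (b -> threshold_closed (Some 1) T) ->
    threshold_closed (tmax k (Some (nat_of_bool b))) T.
  (* When [b] is false the threshold is 0, and the walk is empty, so [x] and [x'] coincide. *)
  rewrite /tmax; case: tle => // _; case: b => [/(_ isT)//|_ x x' z _ _ _].
  by move=> [c [_ <- /=]]; rewrite leqn0 => /nilP ->; exact: edge_mono2.
rewrite /threshold_of in tc *; case: asboolP tc => hD tc.
- have tc' : threshold_closed (max_q H q) T.
    by apply: mu => // /orP h; apply: (threshold_one cT); case: h; [left|right].
  rewrite /star_q; case: ifP => // /orP[/inf|/andP[/orP eta one]].
    by apply=> f ->; rewrite asboolT // orbT.
  apply: (threshold_eta cT); first by case: eta; [left|right].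
  exact: threshold_closed_le tc'.
- have tc' : threshold_closed (max_p H p) T.
    by apply: mu => // h; apply: (threshold_one cT); left.
  rewrite /star_p; case: ifP => // /orP[/inf|/andP[eta one]].
    by apply=> f ->.
  apply: (threshold_eta cT); first by left.
  exact: threshold_closed_le tc'.
Qed.

(** * Soundness *)

Fixpoint quadratic (t : term) : bool :=
  match t with
  | Var _ => true
  | Add t s => quadratic t && quadratic s
  | Mul (Var _) (Var _) => true
  | Mul _ _ => false
  end.

(** Only degrees one and two are kept. A product of three elements of [R12] is [R0], so no longer
    monomial lies below a value that is not greatest. *)
Definition below (A : algebra) (e : nat -> A) (v : A) : set monomial :=
  [set m | match m with
           | [:: x] => leA (e x) v
           | [:: x; y] => leA (e x *' e y) v
           | _ => false
           end].

Definition vanish (A : algebra) (v : A) : Prop := forall y, leA y v.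

Lemma variety_ofP (A : algebra) (H : {set F25}) (p q : threshold) :
  variety_of (H, p, q) A <->
  [/\ VR12 A, forall f, f \in H -> satisfies A (identity_of f),
      forall i, 1 <= i -> tle (Some i) p -> satisfies A (gamma i)
    & forall j, 1 <= j -> tle (Some j) q -> satisfies A (gammaD j)].
Proof.
split=> [[VA EA]|[VA hH hp hq]]; last first.
  split=> // i [[[f fH <-]|[j /andP[j1 jp] <-]]|[j /andP[j1 jp] <-]];
    [exact: hH|exact: hp|exact: hq].
split=> // [f fH|i i1 ip|j j1 jq]; apply: EA.
- by left; left; exists f.
- by left; right; exists i => //=; rewrite i1.
- by right; exists j => //=; rewrite j1.
Qed.

Lemma variety_of_anti (H H' : {set F25}) (p q p' q' : threshold) :
  H \subset H' -> tle p p' -> tle q q' ->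
  variety_of (H', p', q') `<=` variety_of (H, p, q).
Proof.
move=> /fintype.subsetP HH pp qq A /variety_ofP[VA hH hp hq].
apply/variety_ofP; split=> // [f /HH /hH //|i i1 ip|j j1 jq].
- by apply: hp => //; exact: tle_trans pp.
- by apply: hq => //; exact: tle_trans qq.
Qed.

Section Below.

Variables (A : algebra) (VA : VR12 A) (e : nat -> A) (v : A).

Lemma below_mono2 (x y : nat) : below e v (mono2 x y) = leA (e x *' e y) v.
Proof.
rewrite /below /mono2 /sort /= /merge; case: leqP => //= _.
by rewrite (mulCC VA).
Qed.

Lemma below_holds (phi : nat -> nat) (t : term) : quadratic t ->
  holds phi (below e v) t = leA (eval (e \o phi) t) v.
Proof.
elim: t => [i _|t IHt s IHs /= /andP[/IHt qt /IHs qs]|[i| |] // _ [j| |] // _ _].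
- by rewrite holds_Var.
- by rewrite holds_Add qt qs (leA_add VA); apply/propext; split=> /andP.
- by rewrite holds_Mul below_mono2.
Qed.

Lemma below_edge (x y : nat) :
  edge (below e v) x y -> leA (e x *' e y) v.
Proof. by rewrite -below_mono2; exact: edge_mono2. Qed.

Lemma below_path (x : nat) (c : seq nat) : path (edge (below e v)) x c ->
  path (fun y z => leA (e y *' e z) v) x c.
Proof. exact/sub_path/below_edge. Qed.

Lemma below_not_basic_zero : ~ vanish v -> ~ basic_zero (below e v).
Proof.
move=> nv; case=> [[x]|[[|x [|y [|]]]]//|[[|x c] [//= _ oc /andP[pc _]]]].
- by rewrite below_mono2 => xv; apply: nv => y; exact: square_top xv.
- apply: nv => y; apply: (odd_walk_top VA (e := e) (x := x) (c := rcons c x)).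
  + exact: below_path.
  + by rewrite last_rcons.
  + by rewrite size_rcons.
Qed.

Lemma below_environment : ~ vanish v ->
  environment (below e v) = Some (below e v).
Proof.
move=> nv; apply/environment_fixP; split; first exact: below_not_basic_zero.
move=> x y [xv _] [yv _] [c [pc lc oc]]; rewrite below_mono2.
exact: odd_walk_edge (below_path pc) lc oc xv yv.
Qed.

Lemma leA_chain (f : nat -> A) (n : nat) :
  (forall j, j <= n -> leA (f (9 + j) *' f (9 + j.+1)) v) ->
  leA (eval f (chain n)) v.
Proof.
elim: n => [|n IHn] h /=; first exact: (h 0).
by rewrite (leA_add VA) IHn ?(h n.+1) // => j jn; apply: h; exact: ltnW.
Qed.

Section Gamma.

Variables (x z t u n : nat) (c : seq nat).
Hypotheses (n1 : 1 <= n) (sc : size c = n.*2).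
Hypotheses (pc : path (fun y z => leA (e y *' e z) v) x c).
Hypotheses (xv : leA (e x) v) (lv : leA (e (last x c)) v).
Hypothesis lzv : leA (e (last x c) *' e z) v.

(** Variable 1 is the y of gamma, variables 3 and 4 are t and u, and variable 9 + j is x_j, sent to
    the j-th vertex of the walk. The remaining values are fillers. *)
Let f (k : nat) : A :=
  if k < 9 then e (nth z [:: z; z; z; t; u] k) else e (nth x (x :: c) (k - 9)).

Let f_X (j : nat) : f (9 + j) = e (nth x (x :: c) j).
Proof. by rewrite /f ltnNge leq_addr addKn. Qed.

Let gamma_premise_le : leA (eval f (gamma_premise n)) v.
Proof.
rewrite /gamma_premise /= !(leA_add VA) /= -[9]/(9 + 0) !f_X -sc -last_nth.
rewrite [f 1]/f /= xv lv lzv !andbT /=; apply: leA_chain => j jn; rewrite !f_X /=.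
have jc : j < size c by rewrite sc; lia.
by move/(pathP x) : pc; apply.
Qed.

Lemma gamma_walk : satisfies A (gamma n) -> leA (e x *' e z) v.
Proof.
move=> /(_ f) /asboolP h; have := leA_trans VA (h : leA _ _) gamma_premise_le.
by rewrite /= /f.
Qed.

Lemma gammaD_walk : leA (e t) v -> leA (e u) v -> leA (e t *' e u) v ->
  satisfies A (gammaD n) -> leA (e x *' e z) v.
Proof.
move=> tv uv tuv /(_ f) /asboolP h.
have prem : leA (eval f (Add (gamma_premise n) (termD (Var 3) (Var 4)))) v.
  rewrite -[eval _ _]/(eval f (gamma_premise n) +' (f 3 +' f 4 +' f 3 *' f 4)).
  by rewrite (leA_add VA) gamma_premise_le !(leA_add VA) /f /= tv uv tuv.
by have := leA_trans VA (h : leA _ _) prem; rewrite /= /f.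
Qed.

End Gamma.

End Below.

Lemma satisfies_query (A : algebra) (f : F25) (e : nat -> A) : VR12 A ->
  satisfies A (identity_of f) -> leA (eval e (query f)) (eval e (premise f)).
Proof.
move=> VA sA; case: f sA => /(_ e) sA; try exact/asboolP/sA;
  rewrite -?[eval e (premise _)]sA ?leAxx //.
by have := sA; rewrite /= => ->; rewrite leAxx.
Qed.

(** For xi, s and chi the identity is an equation with a square; since squares are greatest, the
    inequality gives it. *)
Lemma query_satisfies (A : algebra) (f : F25) : VR12 A -> f != f_tau ->
  (forall e : nat -> A, leA (eval e (query f)) (eval e (premise f))) ->
  satisfies A (identity_of f).
Proof.
move=> VA; rewrite F25_eqE => ftau /[swap] e /(_ e) h.
have sq (x y : A) : leA (x *' x) y -> x *' x = y.
  move=> xy; have /asboolP := square_top x VA (leAxx VA (x *' x)).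
  have /asboolP := xy; have /asboolP := square_top y VA (leAxx VA (x *' x)).
  by rewrite (addCC VA) => -> .
case: f ftau h => // _ /asboolP hf; try exact: hf; exact/sq/asboolP.
Qed.

Lemma below_closed (A : algebra) (H : {set F25}) (p q : threshold)
    (e : nat -> A) (v : A) :
  tle p q -> variety_of (H, p, q) A -> ~ vanish v ->
  closed_term H p q (below e v).
Proof.
move=> pq /variety_ofP[VA hH hp hq] nv.
have nz := below_not_basic_zero VA (e := e) nv.
split; last exact: below_environment.
- move=> f phi /hH sf; rewrite -!/(holds _ _ _).
  rewrite !(below_holds VA) //; try by case: (f).
  by apply: leA_trans => //; exact: satisfies_query.
rewrite -/(threshold_of p q _) => x x' z [xv _] [x'v _] xx' dk x'z.
(* The walk is even, and half its length [n] respects the threshold, so gamma_n or its D-version is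
   among the identities when [n] is positive. For [n = 0] the two marked vertices coincide. *)
have [n [c [kn pc lc sc]]] : exists n c, [/\ tle (Some n)
    (threshold_of p q (below e v)), path (edge (below e v)) x c,
    last x c = x' & size c = n.*2].
  have [c [pc lc oc]] := xx'.
  have cE d : path (edge (below e v)) x d -> last x d = x' -> size d = (size d)./2.*2.
    move=> pd ld; rewrite -[LHS]odd_double_half.
    by rewrite (walk_odd_eq nz pd pc) ?ld ?lc // (negbTE oc).
  case: threshold_of dk => [k [d [pd ld sd]]|_].
    by exists (size d)./2, d; split=> //; [rewrite /= -leq_double -cE|exact: cE].
  by exists (size c)./2, c; split=> //; exact: cE.
have {}x'z := below_edge VA x'z.
rewrite below_mono2 //; case: n kn sc => [_ /size0nil c0|n kn sc].
  by move: lc x'z; rewrite c0 /= => ->.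
rewrite -lc in x'v x'z; have pc' := below_path VA pc.
move: kn; rewrite /threshold_of; case: asboolP => [[t [u [mt mu tu]]]|_] kn.
  have [_ ev] := iffLR (environment_fixP _) (below_environment VA e nv).
  have := ev t u mt mu tu; rewrite below_mono2 // => tuv.
  case: mt mu => tv _ [uv _].
  by apply: gammaD_walk sc pc' xv x'v x'z tv uv tuv _ => //; exact: hq.
by apply: gamma_walk sc pc' xv x'v x'z _ => //; exact: hp.
Qed.

(** Variable 9 is x_0 and variable 1 is y; the premise of gamma_i is the walk 9, 10, ..., 9 + 2i
    with marked ends, followed by the edge to 1. *)
Lemma below_gamma (A : algebra) (e : nat -> A) (v : A) (k : threshold) (i : nat) :
  VR12 A -> ~ vanish v -> threshold_closed k (below e v) -> 1 <= i ->
  tle (Some i) k -> leA (eval e (gamma_premise i)) v -> leA (e 9 *' e 1) v.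
Proof.
move=> VA nv tc i1 ik; rewrite /= !(leA_add VA).
move=> /andP[/andP[/andP[v0 v2i] vch] v2iy].
have nz := below_not_basic_zero VA (e := e) nv.
have step j : j < i.*2 -> edge (below e v) (9 + j) (9 + j.+1).
  move=> ji; apply: (mono2_edge nz); rewrite below_mono2 //.
  have : j <= i.*2.-1 by lia.
  elim: (i.*2.-1) vch => [|n IHn] /=; first by rewrite leqn0 => ? /eqP ->.
  rewrite (leA_add VA) => /andP[/IHn h hn].
  by rewrite leq_eqVlt => /orP[/eqP ->|].
have last_edge : edge (below e v) (9 + i.*2) 1.
  by apply: (mono2_edge nz); rewrite below_mono2.
have pw : path (edge (below e v)) 9 (iota 10 i.*2).
  apply/(pathP 0) => j; rewrite size_iota => ji.
  rewrite nth_iota // -[10]/(9.+1) addSnnS.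
  by case: j ji => [|j] ji /=; [exact: (step 0)|
    rewrite nth_iota ?(ltnW ji) // -[10]/(9.+1) addSnnS; exact: step].
have lw : last 9 (iota 10 i.*2) = 9 + i.*2.
  by rewrite -nth_last size_iota (set_nth_default 0) ?size_iota ?nth_iota //; lia.
rewrite -(below_mono2 VA); apply: (tc 9 (9 + i.*2) 1) => //.
- by split=> //; exists 10; apply: (step 0); lia.
- by split=> //; exists 1.
- by exists (iota 10 i.*2); rewrite size_iota odd_double.
- case: (k) ik => // n /= ik; exists (iota 10 i.*2).
  by rewrite size_iota leq_double.
Qed.

(** * The order on triples, and [normalize] as a monotone operator preserving the variety *)

Definition le_triple (w w' : triple) : bool :=
  [&& w.1.1 \subset w'.1.1, tle w.1.2 w'.1.2 & tle w.2 w'.2].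

Definition ordered (w : triple) : bool := tle w.1.2 w.2.

Lemma le_triple_refl (w : triple) : le_triple w w.
Proof. by rewrite /le_triple subxx !tle_refl. Qed.

Lemma le_triple_anti (w w' : triple) : le_triple w w' -> le_triple w' w -> w = w'.
Proof.
case: w w' => [[H p] q] [[H' p'] q'] /and3P[/= h1 h2 h3] /and3P[/= g1 g2 g3].
congr (_, _, _); [|exact: tle_anti|exact: tle_anti].
by apply/eqP; rewrite finset.eqEsubset h1.
Qed.

Lemma le_triple_top (w : triple) : le_triple w (finset.setT, None, None).
Proof. by case: w => [[H [p|]] [q|]]; rewrite /le_triple finset.subsetT. Qed.

Lemma tle_tmaxl (p q : threshold) : tle p (tmax p q).
Proof. by have := tle_refl (tmax p q); rewrite {1}/is_true tle_max => /andP[]. Qed.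

Lemma tle_tmax (p q p' q' : threshold) :
  tle p p' -> tle q q' -> tle (tmax p q) (tmax p' q').
Proof.
move=> pp qq; rewrite tle_max; apply/andP.
have := tle_refl (tmax p' q'); rewrite tle_max => /andP[hp hq].
by split; [exact: tle_trans hp|exact: tle_trans hq].
Qed.

Lemma setI_neq0_sub (I J H H' : {set F25}) : I \subset J -> H \subset H' ->
  (H :&: I != finset.set0)%SET -> (H' :&: J != finset.set0)%SET.
Proof.
move=> /fintype.subsetP IJ /fintype.subsetP HH /finset.set0Pn[f /finset.setIP[fH fI]].
by apply/finset.set0Pn; exists f; apply/finset.setIP; split; [exact: HH|exact: IJ].
Qed.

Lemma tle_None (p : threshold) : tle p None.
Proof. by case: p. Qed.

Lemma max_p_le_q (H : {set F25}) (p q : threshold) :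
  tle p q -> tle (max_p H p) (max_q H q).
Proof. by move=> pq; apply: tle_tmax pq _ => /=; case: (f_mu \in H). Qed.

Lemma star_p_le_q (H : {set F25}) (p q : threshold) :
  tle p q -> tle (star_p H p) (star_q H q).
Proof.
move=> pq; have ab := max_p_le_q H pq.
rewrite /star_p; case: ifP => [/orP h|_]; last first.
  by rewrite /star_q; case: ifP => // _; exact: tle_None.
rewrite /star_q ifT //; apply/orP.
case: h => [h|/andP[-> a1]]; [left|right].
  exact: setI_neq0_sub I_0_sub_I_D _ h.
by rewrite (tle_trans a1 ab).
Qed.

Lemma ordered_normalize (w : triple) : ordered w -> ordered (normalize w).
Proof.
case: w => [[H p] q] pq; case: (boolP (f_tau \in H)) => [tH|tH].
  by rewrite normalize_tau.
by rewrite normalizeE //; exact: star_p_le_q.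
Qed.

Lemma le_normalize (w : triple) : le_triple w (normalize w).
Proof.
case: w => [[H p] q]; case: (boolP (f_tau \in H)) => [tH|tH].
  by rewrite normalize_tau // le_triple_top.
rewrite normalizeE // /le_triple /= sub_star_H /=; apply/andP; split.
- by rewrite /star_p; case: ifP => _; [exact: tle_None|exact: tle_tmaxl].
- by rewrite /star_q; case: ifP => _; [exact: tle_None|exact: tle_tmaxl].
Qed.

Lemma normalize_mono (w w' : triple) :
  le_triple w w' -> le_triple (normalize w) (normalize w').
Proof.
case: w w' => [[H p] q] [[H' p'] q'] /and3P[].
rewrite [_.1.1]/= [_.1.2]/= [_.2]/= => HH pp qq.
have sub f : f \in H -> f \in H' by apply/fintype.subsetP.
case: (boolP (f_tau \in H')) => [tH'|tH'].
  by rewrite (normalize_tau _ _ tH') le_triple_top.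
have tH : f_tau \notin H by apply: contra tH'; exact: sub.
rewrite !normalizeE // /le_triple /= star_H_sub //=; apply/andP; split.
- have ab : tle (max_p H p) (max_p H' p').
    apply: tle_tmax pp _ => /=; case: (boolP (f_mu \in H)) => // /sub -> //.
  rewrite /star_p; case: ifP => [/orP h|_]; last first.
    by case: ifP => // _; exact: tle_None.
  rewrite ifT //; apply/orP; case: h => [h|/andP[/sub -> a1]]; [left|right].
    exact: setI_neq0_sub HH h.
  by rewrite (tle_trans a1 ab).
- have ab : tle (max_q H q) (max_q H' q').
    apply: tle_tmax qq _ => /=.
    by case: (boolP (_ || _)) => // /orP[] /sub ->; rewrite ?orbT.
  rewrite /star_q; case: ifP => [/orP h|_]; last first.
    by case: ifP => // _; exact: tle_None.
  rewrite ifT //; apply/orP; case: h => [h|/andP[/orP h a1]]; [left|right].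
    exact: setI_neq0_sub HH h.
  by rewrite (tle_trans a1 ab) andbT; case: h => /sub ->; rewrite ?orbT.
Qed.

(** For the reverse inclusion, let [v] be the value of the right-hand side. Either [v] is greatest,
    or [below e v] is closed for the normalized triple and contains the premise, hence the query. *)
Lemma variety_of_normalize (w : triple) :
  ordered w -> variety_of (normalize w) = variety_of w.
Proof.
move=> ow; apply/seteqP; split.
  move: (le_normalize w); case: w {ow} => [[H p] q].
  case: (normalize _) => [[H' p'] q'] /and3P[h1 h2 h3]; exact: variety_of_anti.
case: w ow => [[H p] q] pq A UA; have /variety_ofP[VA hH _ _] := UA.
case: (boolP (f_tau \in H)) => [tH|tH].
  have triv (x y : A) : x = y.
    exact: (hH _ tH (fun i => if i is 0 then x else y)).
  by rewrite normalize_tau //; apply/variety_ofP; split=> // *; move=> ?; exact: triv.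
rewrite normalizeE //; have closed e v nv :=
  closed_term_star tH pq (@below_closed A H p q e v pq UA nv).
apply/variety_ofP; split=> //.
- move=> f fH; apply: query_satisfies => //.
    by apply: contraTneq fH => ->; exact: tauNstar_H.
  move=> e; set v := eval e (premise f).
  case: (EM (vanish v)) => [nv|nv]; first exact: nv.
  have [ic _ _] := closed e v nv.
  have := ic f id fH; rewrite -!/(holds _ _ _) !below_holds //; try by case: (f).
  by apply; exact: leAxx.
- move=> i i1 ip e; apply/asboolP; set v := eval e (gamma i).2.
  case: (EM (vanish v)) => [nv|nv]; first exact: nv.
  have [_ tc _] := closed e v nv.
  apply: below_gamma VA nv tc i1 _ (leAxx VA _).
  (* [below e v] may have a D-component unrelated to gamma; the larger threshold then applies. *)
  by case: ifP => // _; apply: tle_trans ip _; exact: star_p_le_q.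
- move=> j j1 jq e; apply/asboolP; set v := eval e (gammaD j).2.
  case: (EM (vanish v)) => [nv|nv]; first exact: nv.
  have cT := closed e v nv; have nz := closed_term_nz cT.
  have [_ tc _] := cT.
  have : leA (eval e (gamma_premise j) +' (e 3 +' e 4 +' e 3 *' e 4)) v.
    exact: leAxx VA v.
  rewrite (leA_add VA) => /andP[vg].
  rewrite !(leA_add VA) => /andP[/andP[v3 v4] v34].
  (* The summand D(t,u), on the variables 3 and 4, creates the D-component that puts the second
     threshold in force. *)
  apply: (below_gamma VA nv tc j1 _ vg); rewrite ifT //; apply/asboolP.
  have e34 : edge (below e v) 3 4.
    by apply: (mono2_edge nz); rewrite (below_mono2 VA).
  exists 3, 4; split.
  + by split=> //; exists 4.
  + by split=> //; exists 3; rewrite edge_sym.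
  + by exists [:: 4]; rewrite /= e34.
Qed.

(** * Finite models *)

Lemma setI_eq0_notin (H I : {set F25}) (f : F25) :
  (H :&: I == finset.set0)%SET -> f \in H -> f \notin I.
Proof.
move=> /eqP HI fH; apply/negP => fI.
by have := finset.in_set0 f; rewrite -HI finset.inE fH fI.
Qed.

(* A finite graph with marked vertices is given by the list [l] of its
   monomials. In all models the classes are the parities, and the vertices at
   most [k] and the other vertices are not joined by an edge. *)
Section Model.

Variables (l : seq monomial) (k : nat).

Let V : seq nat := undup (flatten l).
Let E (x y : nat) : bool := mono2 x y \in l.
Let M (x : nat) : bool := [:: x] \in l.
Let nbr (x : nat) : seq nat := filter (E x) V.
Let comp (x : nat) : bool := x <= k.

Definition model_graph : bool :=
  all (fun m => 0 < size m <= 2) l &&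
  all (fun x => all (fun y =>
    E x y ==> (odd x != odd y) && (comp x == comp y)) V) V.

Definition model_environment : bool :=
  all (fun x => all (fun y =>
    [&& M x, M y, odd x != odd y & comp x == comp y] ==> E x y) V) V.

(** An edge between two marked vertices is then a whole component, which is what lambda, mu2,
    epsilon and kappa need. *)
Definition model_isolated : bool :=
  all (fun x => all (fun y => M y ==> all (pred1 y) (nbr x)) (nbr x))
    (filter M V).

Definition model_no_D : bool :=
  all (fun x => all (fun y => M x && M y ==> ~~ E x y) V) V.

Definition model_mu : bool :=
  all (fun b => all (fun a => all (fun c => all (E a) (nbr c)) (nbr b)) (nbr b))
    (filter M V).

Definition model_eta : bool :=
  all (fun x => all (fun y => all M (nbr y)) (nbr x)) (filter M V).

Definition model_one_mark : bool :=
  all (fun x => all (fun y =>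
    [&& M x, M y, odd x == odd y & comp x == comp y] ==> (x == y)) V) V.

Definition model_ok : bool :=
  [&& model_graph, model_environment & model_isolated].

Let M_V (x : nat) : M x -> x \in V.
Proof.
by move=> Mx; rewrite mem_undup; apply/flattenP; exists [:: x]; rewrite ?inE.
Qed.

Let E_Vl (x y : nat) : E x y -> x \in V.
Proof.
move=> Exy; rewrite mem_undup; apply/flattenP; exists (mono2 x y) => //.
by rewrite mem_sort inE eqxx.
Qed.

Let E_sym (x y : nat) : E x y = E y x.
Proof. by rewrite /E mono2C. Qed.

Let E_Vr (x y : nat) : E x y -> y \in V.
Proof. by rewrite E_sym; exact: E_Vl. Qed.

Let T : set monomial := [set` l].

Hypothesis ok : model_ok.

Let graphP (x y : nat) : E x y -> odd y = ~~ odd x /\ comp x = comp y.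
Proof.
move=> Exy; have /and3P[/andP[_ /allP/(_ x (E_Vl Exy))/allP/(_ y (E_Vr Exy))]] := ok.
by rewrite Exy => /andP[h /eqP ->] _ _; split=> //; case: (odd x) (odd y) h => [] [].
Qed.

Let environmentP (x y : nat) :
  M x -> M y -> odd y = ~~ odd x -> comp x = comp y -> E x y.
Proof.
move=> Mx My o c.
have /and3P[_ /allP/(_ x (M_V Mx))/allP/(_ y (M_V My)) + _] := ok.
by rewrite Mx My o c eqxx; case: (odd x).
Qed.

Let mem_nbr (x y : nat) : (y \in nbr x) = E x y.
Proof. by rewrite mem_filter andb_idr //; exact: E_Vr. Qed.

Let mem_marks (x : nat) : (x \in filter M V) = M x.
Proof. by rewrite mem_filter andb_idr //; exact: M_V. Qed.

Let isolatedP (x y z : nat) : M x -> M y -> E x y -> E x z -> z = y.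
Proof.
rewrite -mem_marks -!mem_nbr => Mx My xy xz; have /and3P[_ _] := ok.
by move=> /allP/(_ x Mx)/allP/(_ y xy); rewrite My => /allP/(_ z xz)/eqP.
Qed.

Let model_edge (x y : nat) : edge T x y -> E x y.
Proof. exact: edge_mono2. Qed.

Let walkP (x : nat) (c : seq nat) : path (edge T) x c ->
  odd (last x c) = odd (size c) (+) odd x /\ comp (last x c) = comp x.
Proof.
elim: c x => //= y c IHc x /andP[/model_edge/graphP[oy cxy] /IHc[-> ->]].
by rewrite oy cxy addbN addNb.
Qed.

Let mu_rule (a b c d : nat) : model_mu -> M b -> E a b -> E b c -> E c d -> E a d.
Proof.
rewrite (E_sym a) -mem_marks -!mem_nbr => /allP + Mb ba bc cd.
by rewrite mem_nbr => /(_ b Mb)/allP/(_ a ba)/allP/(_ c bc)/allP/(_ d cd).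
Qed.

Let eta_rule (x y z : nat) : model_eta -> M x -> E x y -> E y z -> M z.
Proof.
rewrite -mem_marks -!mem_nbr => /allP + Mx xy yz.
by move=> /(_ x Mx)/allP/(_ y xy)/allP/(_ z yz).
Qed.

Let no_D_rule (x y : nat) : model_no_D -> M x -> M y -> E x y -> False.
Proof.
move=> /allP + Mx My xy => /(_ x (M_V Mx))/allP/(_ y (M_V My)).
by rewrite Mx My xy.
Qed.

(** Identities of [I_0] are absent from [H]. The others of [I_D] are absent too, or cannot fire for
    want of an edge between marked vertices. Eight identities remain: four hold by [model_isolated],
    while eta, mu and their D-versions are absent, cannot fire or are checked. *)
Lemma model_closed (H : {set F25}) (p q : threshold) :
  (H :&: I_0 == finset.set0)%SET ->
  model_no_D || (H :&: I_D == finset.set0)%SET ->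
  (f_mu \in H) || ~~ model_no_D && (f_muD \in H) ==> model_mu ->
  (f_eta \in H) || ~~ model_no_D && (f_etaD \in H) ==> model_eta ->
  model_one_mark || (p == Some 0) && (model_no_D || (q == Some 0)) ->
  closed_term H p q T.
Proof.
move=> H0 HD hmu heta hk; split.
- move=> f phi fH; rewrite -!/(holds phi T _).
  have fI : f \notin I_0 := setI_eq0_notin H0 fH.
  have noD : f \in I_D -> model_no_D.
    by move=> fD; case/orP: HD => // /setI_eq0_notin/(_ fH)/negP.
  have adj x y : T [:: x] -> T [:: y] -> T (mono2 x y) -> ~~ model_no_D.
    by move=> Tx Ty Txy; apply/negP => nD; exact: no_D_rule nD Tx Ty Txy.
  move: fI noD hmu heta; rewrite !inE !F25_eqE.
  case: f fH => fH //= _; rewrite ?fH ?orbT ?andbT /= => noD hmu heta;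
    rewrite /= /termC /termD /termL !holdsE.
  + by move=> [[Mx xy] yz]; exact: eta_rule heta Mx xy yz.
  + by move=> [[[Mx My] xy] xz]; rewrite (isolatedP Mx My xy xz).
  + move=> [[[Mx xy] yz] [[Mt Mu] tu]].
    by rewrite (adj _ _ Mt Mu tu) orbT in heta; exact: eta_rule heta Mx xy yz.
  + by move=> [_ [[Mt Mu] tu]]; have := adj _ _ Mt Mu tu; rewrite noD.
  + by move=> [[[Mx My] xy] _]; have := adj _ _ Mx My xy; rewrite noD.
  + by move=> [Mb [[ab bc] cd]]; exact: mu_rule hmu Mb ab bc cd.
  + move=> [[Mb Mc] [[ab bc] cd]]; rewrite mono2C in ab.
    rewrite (isolatedP Mb Mc bc ab); rewrite mono2C in bc.
    by rewrite (isolatedP Mc Mb bc cd).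
  + move=> [[Mb [[ab bc] cd]] [[Mt Mu] tu]].
    by rewrite (adj _ _ Mt Mu tu) orbT in hmu; exact: mu_rule hmu Mb ab bc cd.
  + by move=> [_ [[Mt Mu] tu]]; have := adj _ _ Mt Mu tu; rewrite noD.
  + by move=> [[Mx My] xy]; have := adj _ _ Mx My xy; rewrite noD.
  + by move=> [_ [[Mt Mu] tu]]; have := adj _ _ Mt Mu tu; rewrite noD.
  + move=> [[[Ma Mb] _] [[ab bc] cd]]; rewrite mono2C in ab.
    by rewrite -(isolatedP Mb Ma ab bc).
  + move=> [[Ma Mb] [[ab bc] cd]]; rewrite mono2C in ab.
    by rewrite -(isolatedP Mb Ma ab bc).
  + by move=> [_ [[Mt Mu] tu]]; have := adj _ _ Mt Mu tu; rewrite noD.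
- move=> x x' z [Mx _] [Mx' _] [c [/walkP pc lc oc]] dk /model_edge x'z.
  suff -> : x = x' by [].
  case/orP: hk => [/allP/(_ x (M_V Mx))/allP/(_ x' (M_V Mx'))|/andP[/eqP p0 q0]].
    move: pc; rewrite lc (negbTE oc) addFb => -[-> ->].
    have Mx1 : M x := Mx; have Mx1' : M x' := Mx'.
    by rewrite Mx1 Mx1' !eqxx => /eqP.
  have : threshold_of p q T = Some 0.
    rewrite /threshold_of; case: asboolP => // -[t [u [[Mt _] [Mu _] tu]]].
    case/orP: q0 => [nD|/eqP //]; exfalso; apply: (no_D_rule nD Mt Mu).
    by apply: environmentP => //; move: tu => [d [/walkP[od cd] ld ood]];
      move: od cd; rewrite ld ood.
  rewrite /threshold_of => k0; move: dk; rewrite k0 => -[d [_ <- /=]].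
  by rewrite leqn0 => /nilP ->.
- apply/environment_fixP; split.
    case=> [[x /graphP[]]|[m Tm m3]|[[|x c] [//= _ oc /andP[/walkP[+ _] _]]]].
    + by case: odd.
    + have /andP[/andP[/allP/(_ m Tm) + _] _] := ok.
      by rewrite [_ <= 2]leqNgt m3 andbF.
    + by rewrite last_rcons size_rcons /=; move: oc => /= -> /=; case: odd.
  move=> x y [Mx _] [My _] [c [/walkP[od cd] lc oc]]; apply: environmentP => //.
    by move: od; rewrite lc oc.
  by rewrite -cd lc.
Qed.

Lemma model_notin_star (H : {set F25}) (p q : threshold) (f : F25) :
  closed_term H p q T -> all (mem l) (monomials (premise f)) ->
  ~~ all (mem l) (monomials (query f)) -> f \notin star_H H p q.
Proof.
move=> cT /allP hv; apply: contra => /star_HP /(_ T cT) h.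
apply/allP => m hm; apply: (iffLR (holds_id T _)) hm; apply: h.
exact/holds_id.
Qed.

End Model.

Definition model_ok_for (l : seq monomial) (k : nat) (f : F25) : bool :=
  [&& model_ok l k, all (mem l) (monomials (premise f))
    & ~~ all (mem l) (monomials (query f))].

(** The numbering of variables separates the parts of a premise: 1 splits x, y from z, t; 2 splits
    x, y, z from t, u; 4 splits the first five variables from a, b, c, d and the x_j. *)
Definition model_cut (f : F25) : nat :=
  match f with
  | f_zeta | f_beta | f_zetaD => 1
  | f_etaD | f_omegaD => 2
  | _ => 4
  end.

(* The premise of [f], closed under mu. *)
Definition mu_model (f : F25) : seq monomial :=
  monomials (premise f) ++
  match f with f_iota2 | f_iota2D => [:: [:: 9; 12]] | _ => [::] end.

(* The premise of [f], closed under eta. *)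
Definition eta_model (f : F25) : seq monomial :=
  monomials (premise f) ++
  match f with
  | f_alpha | f_alphaD => [:: [:: 7]]
  | f_iota2 | f_iota2D => [:: [:: 12]; [:: 14]]
  | f_mu | f_muD => [:: [:: 8]]
  | _ => [::]
  end.

(** The identities relevant to the first threshold. Their models have no edge between marked
    vertices, so rules with D(t,u) never fire. *)
Definition has_no_D (f : F25) : bool := (f \in I_0) || (f \in [:: f_eta; f_mu]).

(** For iota2 and its D-version, mu at the marked x_1 forces the extra edge x_0 x_3, that is
    [[:: 9; 12]], and stops there: x_0 x_5 stays absent. *)
Lemma mu_model_ok (f : F25) : f \in [:: f_eta; f_etaD] \/ f \in I_D ->
  f != f_tau -> [&& model_ok_for (mu_model f) (model_cut f) f,
    has_no_D f ==> model_no_D (mu_model f), model_mu (mu_model f)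
    & model_one_mark (mu_model f) (model_cut f)].
Proof.
rewrite /has_no_D /I_D !inE !F25_eqE => h; case: f h => //= h _;
  try (by case: h); vm_compute; reflexivity.
Qed.

(** The extra marks are those at even distance from the given one: c for alpha, x_3 and x_5 for
    iota2, d for mu. All lie in one class, so the environment rule adds nothing. *)
Lemma eta_model_ok (f : F25) : f \in [:: f_mu; f_muD] \/ f \in I_D ->
  f != f_tau -> [&& model_ok_for (eta_model f) (model_cut f) f,
    has_no_D f ==> model_no_D (eta_model f) & model_eta (eta_model f)].
Proof.
rewrite /has_no_D /I_D !inE !F25_eqE => h; case: f h => //= h _;
  try (by case: h); vm_compute; reflexivity.
Qed.

(** * Idempotence of [normalize] *)

Lemma I_D_eq0 (H : {set F25}) :
  (H :&: I_D == finset.set0)%SET -> (H :&: I_0 == finset.set0)%SET.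
Proof.
by apply: contraTT; exact: setI_neq0_sub I_0_sub_I_D (fintype.subxx H).
Qed.

Lemma mu_model_notin (H : {set F25}) (p q : threshold) (f : F25) :
  (H :&: I_0 == finset.set0)%SET -> f_eta \notin H ->
  has_no_D f || (H :&: I_D == finset.set0)%SET && (f_etaD \notin H) ->
  f \in [:: f_eta; f_etaD] \/ f \in I_D -> f \notin star_H H p q.
Proof.
move=> H0 eta noD fI; have tH : f_tau \notin H.
  by apply/negP => /(setI_eq0_notin H0); rewrite !inE !F25_eqE.
case: (eqVneq f f_tau) => [->|ftau]; first exact: tauNstar_H.
have /and4P[/and3P[ok hv hq] nD mu one] := mu_model_ok fI ftau.
apply: model_notin_star hv hq; apply: (model_closed ok) => //.
- by case/orP: noD => [h|/andP[-> _]]; rewrite ?orbT // (implyP nD h).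
- by rewrite mu implybT.
- rewrite (negbTE eta) /=; apply/implyP => /andP[nnD etaD].
  case/orP: noD => [h|/andP[_ /negP//]].
  by rewrite (implyP nD h) in nnD.
- by rewrite one.
Qed.

Lemma eta_model_notin (H : {set F25}) (q : threshold) (f : F25) :
  (H :&: I_0 == finset.set0)%SET -> f_mu \notin H ->
  has_no_D f ||
    [&& (H :&: I_D == finset.set0)%SET, f_muD \notin H & q == Some 0] ->
  f \in [:: f_mu; f_muD] \/ f \in I_D -> f \notin star_H H (Some 0) q.
Proof.
move=> H0 muH noD fI; have tH : f_tau \notin H.
  by apply/negP => /(setI_eq0_notin H0); rewrite !inE !F25_eqE.
case: (eqVneq f f_tau) => [->|ftau]; first exact: tauNstar_H.
have /and3P[/and3P[ok hv hq] nD eta] := eta_model_ok fI ftau.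
apply: model_notin_star hv hq; apply: (model_closed ok) => //.
- by case/orP: noD => [h|/andP[-> _]]; rewrite ?orbT // (implyP nD h).
- rewrite (negbTE muH) /=; apply/implyP => /andP[nnD muD].
  case/orP: noD => [h|/and3P[_ /negP//]].
  by rewrite (implyP nD h) in nnD.
- by rewrite eta implybT.
- by case/orP: noD => [h|/and3P[_ _ ->]]; rewrite ?orbT // (implyP nD h) orbT.
Qed.

Lemma setI_eq0P (H I : {set F25}) :
  (forall f, f \in I -> f \notin H) -> (H :&: I == finset.set0)%SET.
Proof.
move=> h; apply/negPn/negP => /finset.set0Pn[f /finset.setIP[fH /h]].
by rewrite fH.
Qed.

Lemma max_p_eq0 (H : {set F25}) (p : threshold) :
  ~~ tle (Some 1) (max_p H p) -> p = Some 0 /\ f_mu \notin H.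
Proof. by rewrite /max_p Some_tle_max; case: p (f_mu \in H) => [[]|] []. Qed.

Lemma max_q_eq0 (H : {set F25}) (q : threshold) :
  ~~ tle (Some 1) (max_q H q) -> [/\ q = Some 0, f_mu \notin H & f_muD \notin H].
Proof.
rewrite /max_q Some_tle_max.
by case: q (f_mu \in H) (f_muD \in H) => [[]|] [] [].
Qed.

Lemma tmax_bool (k : threshold) (b : bool) :
  (b -> tle (Some 1) k) -> tmax k (Some (nat_of_bool b)) = k.
Proof.
rewrite /tmax; case: k b => [k|] [] //= => [/(_ isT) k1|_]; case: ifP => // kb;
  by congr Some; lia.
Qed.

Lemma star_p_idem (H : {set F25}) (p q : threshold) :
  star_p (star_H H p q) (star_p H p) = star_p H p.
Proof.
rewrite {2 3}/star_p; case: ifP => [_|/norP[]].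
  by rewrite /star_p /max_p /tmax /=; case: ifP.
move=> /negPn H0; rewrite negb_and => h.
have {h} hA : tle (Some 1) (max_p H p) -> f_eta \notin H.
  by move=> a1; rewrite a1 orbF in h.
case: (boolP (tle (Some 1) (max_p H p))) => [a1|a0].
  (* Neither eta nor an element of [I_0] can enter; mu may, harmlessly, as the threshold is already
     positive. *)
  have eta := hA a1.
  have A f : f \in I_0 \/ f = f_eta -> f \notin star_H H p q.
    move=> fI; apply: mu_model_notin => //.
      by rewrite /has_no_D; case: fI => [->|->] //; rewrite mem_head orbT.
    case: fI => [/(fintype.subsetP I_0_sub_I_D)|->]; first by right.
    by left; rewrite mem_head.
  rewrite /star_p (_ : max_p _ (max_p H p) = max_p H p); last exact: tmax_bool.
  rewrite (negbTE (A f_eta _)) ?orbF ?setI_eq0P //; last by right.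
  by move=> f fI; apply: A; left.
have [p0 mu] := max_p_eq0 a0.
(* Here the roles are exchanged: eta may enter, harmlessly, because the threshold stays 0 as long as
   mu does not. *)
have B f : f \in I_0 \/ f = f_mu -> f \notin star_H H p q.
  move=> fI; rewrite p0; apply: eta_model_notin => //.
    by rewrite /has_no_D; case: fI => [->|->] //; rewrite !inE eqxx !orbT.
  case: fI => [/(fintype.subsetP I_0_sub_I_D)|->]; first by right.
  by left; rewrite mem_head.
have max0 : max_p (star_H H p q) (max_p H p) = max_p H p.
  by apply: tmax_bool => muS; have := B f_mu (or_intror erefl); rewrite muS.
rewrite /star_p max0 (negbTE a0) andbF orbF setI_eq0P //.
by move=> f fI; apply: B; left.
Qed.

Lemma star_q_idem (H : {set F25}) (p q : threshold) : tle p q ->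
  star_q (star_H H p q) (star_q H q) = star_q H q.
Proof.
move=> pq; rewrite {2 3}/star_q; case: ifP => [_|/norP[]].
  by rewrite /star_q /max_q /tmax /=; case: ifP.
move=> /negPn HD; rewrite negb_and => h.
have {h} hA : tle (Some 1) (max_q H q) -> (f_eta \notin H) && (f_etaD \notin H).
  by move=> a1; rewrite a1 orbF negb_or in h.
have H0 := I_D_eq0 HD.
case: (boolP (tle (Some 1) (max_q H q))) => [a1|a0].
  have /andP[eta etaD] := hA a1.
  have A f : f \in [:: f_eta; f_etaD] \/ f \in I_D -> f \notin star_H H p q.
    by move=> fI; apply: mu_model_notin => //; rewrite HD etaD orbT.
  rewrite /star_q (_ : max_q _ (max_q H q) = max_q H q); last exact: tmax_bool.
  rewrite (negbTE (A f_eta _)) ?(negbTE (A f_etaD _)) ?orbF ?setI_eq0P //.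
  - by move=> f fI; apply: A; right.
  - by left; rewrite !inE eqxx orbT.
  - by left; rewrite mem_head.
have [q0 mu muD] := max_q_eq0 a0.
have p0 : p = Some 0 by move: pq; rewrite q0; case: (p) => // -[].
have B f : f \in [:: f_mu; f_muD] \/ f \in I_D -> f \notin star_H H p q.
  by move=> fI; rewrite p0; apply: eta_model_notin => //; rewrite HD muD q0 orbT.
have max0 : max_q (star_H H p q) (max_q H q) = max_q H q.
  apply: tmax_bool => /orP[]; apply: contraTT => _; apply: B; left.
    exact: mem_head.
  by rewrite !inE eqxx orbT.
rewrite /star_q max0 (negbTE a0) andbF orbF setI_eq0P //.
by move=> f fI; apply: B; right.
Qed.

Lemma normalize_idem (w : triple) :
  ordered w -> normalize (normalize w) = normalize w.
Proof.
case: w => [[H p] q] pq; case: (boolP (f_tau \in H)) => [tH|tH].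
  by rewrite normalize_tau // normalize_tau ?finset.in_setT.
rewrite (normalizeE _ _ tH) normalizeE ?tauNstar_H //.
rewrite star_p_idem star_q_idem //; congr (_, _, _).
apply/eqP; rewrite finset.eqEsubset sub_star_H andbT; apply/fintype.subsetP => f.
move=> /star_HP h; apply/star_HP => T cT; apply: h; exact: closed_term_star cT.
Qed.

(** * The lattice of subvarieties *)

Definition join_triple (w w' : triple) : triple :=
  ((w.1.1 :|: w'.1.1)%SET, tmax w.1.2 w'.1.2, tmax w.2 w'.2).

Definition meet_triple (w w' : triple) : triple :=
  ((w.1.1 :&: w'.1.1)%SET, tmin w.1.2 w'.1.2, tmin w.2 w'.2).

Lemma join_tripleP (w w' w'' : triple) :
  le_triple (join_triple w w') w'' = le_triple w w'' && le_triple w' w''.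
Proof.
by rewrite /le_triple /= finset.subUset !tle_max [X in _ && X]andbACA andbACA.
Qed.

Lemma meet_tripleP (w w' w'' : triple) :
  le_triple w'' (meet_triple w w') = le_triple w'' w && le_triple w'' w'.
Proof.
by rewrite /le_triple /= finset.subsetI !tle_min [X in _ && X]andbACA andbACA.
Qed.

Lemma variety_of_le (w w' : triple) :
  le_triple w w' -> variety_of w' `<=` variety_of w.
Proof.
by case: w w' => [[H p] q] [[H' p'] q'] /and3P[*]; exact: variety_of_anti.
Qed.

Lemma variety_of_join (w w' : triple) :
  variety_of (join_triple w w') = variety_of w `&` variety_of w'.
Proof.
apply/seteqP; split=> [A jA|A [wA w'A]].
  have := le_triple_refl (join_triple w w'); rewrite join_tripleP => /andP[h h'].
  by split; exact: variety_of_le jA.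
case: w w' wA w'A => [[H p] q] [[K r] s] /variety_ofP[VA hH hp hq].
move=> /variety_ofP[_ hK hr hs]; apply/variety_ofP; split=> // i.
- by move=> /finset.setUP[/hH|/hK].
- by rewrite Some_tle_max => i1 /orP[/hp|/hr]; apply.
- by rewrite Some_tle_max => i1 /orP[/hq|/hs]; apply.
Qed.

Lemma ordered_join (w w' : triple) :
  ordered w -> ordered w' -> ordered (join_triple w w').
Proof. by move=> ow ow'; apply: tle_tmax. Qed.

Lemma ordered_meet (w w' : triple) :
  ordered w -> ordered w' -> ordered (meet_triple w w').
Proof.
move=> ow ow'; rewrite /ordered /= tle_min; apply/andP.
have := tle_refl (tmin w.1.2 w'.1.2); rewrite tle_min => /andP[h h'].
by split; [exact: tle_trans ow|exact: tle_trans ow'].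
Qed.

Lemma normalized_ordered (w : triple) : normalized w -> ordered w.
Proof. by case. Qed.

Lemma normalized_normalize (w : triple) : ordered w -> normalized (normalize w).
Proof. by move=> ow; split; [exact: ordered_normalize|exact: normalize_idem]. Qed.

(** Fixed points of a closure operator are stable under meets, so the join of varieties needs no
    normalization. *)
Lemma normalized_meet (w w' : triple) :
  normalized w -> normalized w' -> normalized (meet_triple w w').
Proof.
move=> [ow nw] [ow' nw']; split; first exact: ordered_meet.
apply: le_triple_anti (le_normalize _); rewrite meet_tripleP.
have := le_triple_refl (meet_triple w w'); rewrite meet_tripleP => /andP[h h'].
by rewrite -{2}nw -{3}nw' !normalize_mono.
Qed.

Lemma candidates_above (w c : triple) : ordered w -> c \in candidates w ->
  [/\ ordered c, le_triple w c & ~~ le_triple c w].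
Proof.
case: w => [[H p] q] ow; rewrite /candidates !mem_cat => /or3P[].
- case/mapP => f; rewrite mem_enum finset.inE => fH ->; split=> //.
    by rewrite /le_triple !tle_refl /= !andbT finset.subsetUr.
  apply/negP => /and3P[/fintype.subsetP/(_ f) + _ _].
  by rewrite /= finset.setU11 (negbTE fH) => /(_ isT).
- case: p ow => [m|//] ow; rewrite inE => /eqP ->; split.
  + by have := tle_refl (tmax q (Some m.+1)); rewrite tle_max => /andP[].
  + rewrite /le_triple /= fintype.subxx leqnSn /=; exact: tle_tmaxl.
  + by rewrite /le_triple /= ltnn andbF.
- case: q ow => [m|//] ow; rewrite inE => /eqP ->; split.
  + by apply: tle_trans ow _ => /=.
  + by rewrite /le_triple /= fintype.subxx tle_refl /=.
  + by rewrite /le_triple /= ltnn !andbF.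
Qed.

Lemma candidates_below (w w' : triple) :
  ordered w' -> le_triple w w' -> w != w' ->
  exists2 c, c \in candidates w & le_triple c w'.
Proof.
case: w w' => [[H p] q] [[H' p'] q'] ow' /and3P[/= HH pp qq] neq.
have [H'H|/fintype.subsetPn[f fH' fH]] := boolP (H' \subset H); last first.
  exists ((f |: H)%SET, p, q).
    rewrite mem_cat; apply/orP; left; apply/mapP; exists f => //.
    by rewrite mem_enum finset.inE.
  by rewrite /le_triple /= pp qq finset.subUset finset.sub1set fH' HH.
have [p'p|pp'] := boolP (tle p' p); last first.
  case: p pp pp' neq => [m|] pp pp' _; last by case: (p') pp'.
  have mp' : tle (Some m.+1) p' by case: (p') pp' => //= n; rewrite -ltnNge.
  exists (H, Some m.+1, tmax q (Some m.+1)).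
    by rewrite /candidates !mem_cat mem_head orbT.
  apply/and3P; split; [exact: HH|exact: mp'|].
  (* Raising the second threshold along with the first stays below [w'], because [w'] is ordered. *)
  by rewrite tle_max qq; exact: tle_trans ow'.
have [q'q|] := boolP (tle q' q); last first.
  case: q qq neq => [m|] qq _ qq'; last by case: (q') qq'.
  have mq' : tle (Some m.+1) q' by case: (q') qq' => //= n; rewrite -ltnNge.
  exists (H, p, Some m.+1); last by apply/and3P.
  by rewrite /candidates !mem_cat mem_head !orbT.
by case/eqP: neq; apply: le_triple_anti; apply/and3P.
Qed.

Lemma size_candidates (w : triple) : size (candidates w) <= 27.
Proof.
case: w => [[H p] q]; rewrite !size_cat size_map -cardE.
have : #|(~: H)%SET| <= 25.
  apply: leq_trans (max_card _) _; rewrite -[25]card_ord.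
  exact: leq_card (can_inj F25_indexK).
by case: p q => [p|] [q|] /=; lia.
Qed.

(** * Consequences of the bijection *)

Section Signature.

Hypothesis sigma_bij : set_bij normalized subvariety variety_of.

Lemma variety_of_inj (w w' : triple) : normalized w -> normalized w' ->
  variety_of w = variety_of w' -> w = w'.
Proof. by case: sigma_bij => _ inj _ nw nw'; apply: inj; exact/mem_set. Qed.

Lemma signature_variety_of (w : triple) : ordered w ->
  signature (variety_of w) = normalize w.
Proof.
move=> ow; have nw := normalized_normalize ow.
have := @xgetI _ (finset.set0, Some 0, Some 0)
  [set w' | normalized w' /\ variety_of w' = variety_of w] (normalize w).
rewrite -/(signature _) => /(_ (conj nw (variety_of_normalize ow))) [ns es].
by apply: variety_of_inj => //; rewrite es variety_of_normalize.
Qed.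

(** Inclusion says that the intersection is the smaller variety. The joined triple then normalizes
    to [w] by injectivity, which puts [w] above [w']. *)
Lemma variety_of_sub (w w' : triple) : normalized w -> ordered w' ->
  variety_of w `<=` variety_of w' <-> le_triple w' w.
Proof.
move=> nw ow'; split=> [sub|]; last exact: variety_of_le.
have ow := normalized_ordered nw; have oj := ordered_join ow ow'.
have {1}-> : w = normalize (join_triple w w').
  apply: variety_of_inj => //; first exact: normalized_normalize.
  by rewrite variety_of_normalize // variety_of_join setIidl.
have := le_normalize (join_triple w w').
by rewrite join_tripleP => /andP[].
Qed.

(** Surjectivity represents the varietal join by a triple [w0]. It lies below [w] and [w'], hence
    below their meet, which is the inclusion not given by monotonicity. *)
Lemma variety_of_meet (w w' : triple) : normalized w -> normalized w' ->
  variety_of (meet_triple w w') = variety_join (variety_of w) (variety_of w').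
Proof.
move=> nw nw'; apply/seteqP; split; last first.
  apply: variety_generated_min.
    by have [] := variety_of_subvariety (meet_triple w w').
  have := le_triple_refl (meet_triple w w'); rewrite meet_tripleP => /andP[h h'].
  by move=> A []; exact: variety_of_le.
have sj := subvariety_join (variety_of_subvariety w) (variety_of_subvariety w').
have [_ _ surj] := sigma_bij; have [w0 nw0 e0] := surj _ sj.
have up : variety_of w `|` variety_of w' `<=` variety_of w0.
  by rewrite e0; exact: sub_variety_generated.
rewrite -e0; apply: variety_of_le; rewrite meet_tripleP; apply/andP.
split; apply/variety_of_sub => //; try exact: normalized_ordered.
  by move=> A wA; apply: up; left.
by move=> A wA; apply: up; right.
Qed.

(** * Lower covers *)

Section Covers.

Variable w : triple.
Hypothesis nw : normalized w.

Lemma candidate_proper (c : triple) :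
  c \in candidates w -> variety_of c `<` variety_of w.
Proof.
move=> /(candidates_above (normalized_ordered nw)) [oc wc ncw].
split; first exact: variety_of_le.
by move=> /(variety_of_sub nw oc); exact/negP.
Qed.

Lemma proper_candidate (X : set algebra) : subvariety X -> X `<` variety_of w ->
  exists2 c, c \in candidates w & X `<=` variety_of c.
Proof.
have [_ _ surj] := sigma_bij; move=> /surj [w' nw' <-] [sub nsub].
have le := iffLR (variety_of_sub nw' (normalized_ordered nw)) sub.
have [|c cw cw'] := candidates_below (normalized_ordered nw') le.
  by apply: contra_notN nsub => /eqP ->.
by exists c => //; exact: variety_of_le.
Qed.

(** A candidate is not below [w] and normalization only enlarges it, so its normal form differs from
    [w]. *)
Lemma mem_normalized_candidates (c : triple) :
  reflect (exists2 c', c' \in candidates w & c = normalize c')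
    (c \in normalized_candidates w).
Proof.
rewrite mem_undup mem_filter; apply: (iffP andP) => [[_ /mapP //]|[c' c'w ->]].
split; last exact: map_f.
have [_ _] := candidates_above (normalized_ordered nw) c'w.
by apply: contra => /eqP <-; exact: le_normalize.
Qed.

Lemma lower_cover_candidate (X : set algebra) : lower_cover X (variety_of w) ->
  exists2 c, c \in candidates w & X = variety_of c.
Proof.
move=> [sX _ Xw none]; have [c cw Xc] := proper_candidate sX Xw.
exists c => //; apply/seteqP; split=> //; apply: contrapT => ncX; apply: none.
exists (variety_of c); split; [exact: variety_of_subvariety|by split|].
exact: candidate_proper.
Qed.

Lemma signature_lower_covers :
  signature @` [set X | lower_cover X (variety_of w)] =
  [set` maximal_candidates w].
Proof.
have oc c : c \in candidates w -> ordered c.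
  by case/(candidates_above (normalized_ordered nw)).
apply/seteqP; split=> [_ [X cX <-]|c].
  have [c cw Xc] := lower_cover_candidate cX.
  rewrite Xc (signature_variety_of (oc _ cw)) /= mem_filter; apply/andP; split.
    apply/allP => _ /mem_normalized_candidates [c' c'w ->]; apply/asboolPn.
    (* A strictly larger candidate would lie strictly between [X] and the variety of [w]. *)
    rewrite !variety_of_normalize ?oc // => cc'; have [_ _ _] := cX; apply.
    exists (variety_of c'); rewrite Xc; split=> //.
      exact: variety_of_subvariety.
    exact: candidate_proper.
  by apply/mem_normalized_candidates; exists c.
rewrite /= mem_filter => /andP[/allP max /mem_normalized_candidates [c0 c0w cE]].
exists (variety_of c0); last by rewrite signature_variety_of ?oc.
split; [exact: variety_of_subvariety|exact: variety_of_subvariety| |].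
  exact: candidate_proper.
(* A variety [Z] in between is contained in some candidate [c1], which strictly contains [c0] and
   contradicts its maximality. *)
move=> [Z [sZ [c0Z nZc0] Zw]]; have [c1 c1w Zc1] := proper_candidate sZ Zw.
have /max/asboolPn : normalize c1 \in normalized_candidates w.
  by apply/mem_normalized_candidates; exists c1.
apply; rewrite cE !variety_of_normalize ?oc //; split.
  exact: subset_trans Zc1.
by move=> c1c0; apply: nZc0; exact: subset_trans c1c0.
Qed.

End Covers.

End Signature.

Theorem proposition7p5
    (sigma_bij : set_bij normalized subvariety variety_of)
    (H K : {set F25}) (p q r s : threshold)
    (nU : normalized (H, p, q)) (nW : normalized (K, r, s)) :
  let U := variety_of (H, p, q) in
  let W := variety_of (K, r, s) in
  [/\ U `<=` W <-> [/\ K \subset H, tle r p & tle s q],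
      signature (U `&` W) = normalize ((H :|: K)%SET, tmax p r, tmax q s),
      signature (variety_join U W) = ((H :&: K)%SET, tmin p r, tmin q s),
      size (candidates (H, p, q)) <= 27 /\
        (forall X, lower_cover X U ->
           exists2 c, c \in candidates (H, p, q) & X = variety_of c)
    & signature @` [set X | lower_cover X U] =
        [set` maximal_candidates (H, p, q)]].
Proof.
move=> U W; have [oU oW] := (normalized_ordered nU, normalized_ordered nW).
split.
- by rewrite (variety_of_sub sigma_bij nU oW); split=> /and3P.
- rewrite -variety_of_join (signature_variety_of sigma_bij) //.
  exact: ordered_join.
- have nM := normalized_meet nU nW.
  rewrite -(variety_of_meet sigma_bij nU nW) (signature_variety_of sigma_bij).
    by case: nM.
  exact: normalized_ordered.
- split; first exact: size_candidates.
  exact: lower_cover_candidate.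
- exact: signature_lower_covers.
Qed.
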